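(* Let $n$ be a positive integer with $n\ne 5,6$, and call an $n$-vertex graph extremal for $T$ if it contains no subgraph isomorphic to $T$ and has exactly $\mathrm{ex}(n,T)$ edges. Up to isomorphism: if $n\equiv 0\pmod 4$, the only extremal graph for $T$ is $T^{n/2}_n$; if $n\equiv 1\pmod 4$, the extremal graphs are exactly $T^{\lceil n/2\rceil}_n$ and $S^{\lceil n/2\rceil}_n$; if $n\equiv 2\pmod 4$, the extremal graphs are exactly $T^{n/2}_n$, $T^{n/2+1}_n$ and $S^{n/2}_n$; if $n\equiv 3\pmod 4$, the extremal graphs are exactly $T^{\lceil n/2\rceil}_n$ and $S^{\lceil n/2\rceil}_n$.
   Context: All graphs are finite, simple and undirected. $T$ is the graph on six vertices $a,b,c,d,e,f$ with edges $bc, ce, eb, ab, ac, bd, de, cf, fe$ (a triangle $bce$ with a triangle erected on each of its edges). $\mathrm{ex}(n,H)$ is the maximum number of edges in an $n$-vertex graph not containing $H$ as a subgraph. For $1\le i\le n-1$, consider $K_{i,n-i}$ with classes $X$, $|X|=i$, and $Y$, $|Y|=n-i$. $T^i_n$ is obtained from it by adding a maximum matching inside $X$ and a maximum matching inside $Y$. $S^i_n$ is obtained from it by adding inside $X$ a star spanning all $i$ vertices of $X$ (one center of $X$ joined to the other $i-1$ vertices of $X$). *)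

(* Defs.v *)
From HB Require Import structures.
From mathcomp Require Import all_boot.

Set Implicit Arguments.
Unset Strict Implicit.
Unset Printing Implicit Defensive.

Record sgraph (V : finType) := SGraph {
  edges : {set {set V}};
  edges2 : [forall e in edges, #|e| == 2]
}.

HB.instance Definition _ (V : finType) := [isSub for @edges V].
HB.instance Definition _ (V : finType) := [Finite of sgraph V by <:].

(* The edges are the pairs {x, y} with x != y and r x y or r y x: loops of r
   are dropped and r is symmetrized. *)
Definition rel_edges (V : finType) (r : rel V) : {set {set V}} :=
  [set [set x; y] | x in V, y in V & (x != y) && r x y].

Lemma rel_edges2 (V : finType) (r : rel V) :
  [forall e in rel_edges r, #|e| == 2].
Proof.
apply/forall_inP => e /imset2P[x y _]; rewrite inE => /and3P[_ xy _] ->.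
by rewrite cards2 xy.
Qed.

Definition rel_graph (V : finType) (r : rel V) : sgraph V :=
  SGraph (rel_edges2 r).

Lemma rel_graphE (V : finType) (r : rel V) (x y : V) :
  ([set x; y] \in edges (rel_graph r)) = (x != y) && (r x y || r y x).
Proof.
apply/imset2P/andP => [[u v _] | [xy /orP[rxy|ryx]]]; last 2 first.
- by exists x y; rewrite ?inE ?xy.
- by exists y x; rewrite ?inE ?(eq_sym y) ?xy // setUC.
rewrite inE => /and3P[_ uv ruv] E.
have xy : x != y.
  by have /eqP := congr1 (fun A : {set V} => #|A|) E;
     rewrite !cards2 uv; case: (x != y).
have : x \in [set u; v] by rewrite -E set21.
have : y \in [set u; v] by rewrite -E set22.
move: xy; rewrite !inE => xy /orP[] /eqP Ey /orP[] /eqP Ex;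
  by move: xy; rewrite Ex Ey ?eqxx // ruv ?orbT.
Qed.

Definition graph_iso (V W : finType) (G : sgraph V) (H : sgraph W) : Prop :=
  exists2 f : V -> W, bijective f &
    edges H = [set f @: e | e : {set V} in edges G].

(* H is isomorphic to a not necessarily induced subgraph of G. *)
Definition contains (V W : finType) (G : sgraph V) (H : sgraph W) : bool :=
  [exists f : {ffun W -> V},
    injectiveb f && [forall e in edges H, f @: e \in edges G]].

(* The maximum is over a nonempty family as soon as H has an edge. *)
Definition ex (n : nat) (W : finType) (H : sgraph W) : nat :=
  \max_(G : sgraph 'I_n | ~~ contains G H) #|edges G|.

Definition extremal (V W : finType) (H : sgraph W) (G : sgraph V) : Prop :=
  ~~ contains G H /\ #|edges G| = ex #|V| H.

(* The vertices a, b, c, d, e, f are 0, 1, 2, 3, 4, 5. *)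
Definition graphT : sgraph 'I_6 :=
  rel_graph [rel x y : 'I_6 | (val x, val y) \in
    [:: (1, 2); (2, 4); (4, 1); (0, 1); (0, 2); (1, 3); (3, 4); (2, 5); (5, 4)]].

(* K_{i,j} with rX added inside the class X = 'I_i and rY inside Y = 'I_j. *)
Definition bip_rel (i j : nat) (rX : rel 'I_i) (rY : rel 'I_j) :
    rel ('I_i + 'I_j)%type :=
  fun u v => match u, v with
             | inl x, inl x' => rX x x'
             | inr y, inr y' => rY y y'
             | _, _ => true
             end.

(* The pairs {0, 1}, {2, 3}, ...: a maximum matching of the complete graph on
   'I_k (with loops, dropped by rel_graph). *)
Definition matching_rel (k : nat) : rel 'I_k := fun x y => x./2 == y./2.

(* The star centred at 0. *)
Definition star_rel (k : nat) : rel 'I_k := fun x _ => val x == 0.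

(* Both graphs have n vertices when i <= n; for i = n the class Y is empty. *)
Definition T_graph (n i : nat) : sgraph ('I_i + 'I_(n - i))%type :=
  rel_graph (bip_rel (@matching_rel i) (@matching_rel (n - i))).

Definition S_graph (n i : nat) : sgraph ('I_i + 'I_(n - i))%type :=
  rel_graph (bip_rel (@star_rel i) (fun _ _ => false)).

(* Main.v *)
Require Import Defs.
From mathcomp Require Import all_boot zify.

(* Let f n be the claimed maximum. If G contains K_5 minus an edge on a set D,
   then T-freeness leaves each outside vertex at most two neighbours in D, and
   deleting D shows by induction that G has fewer than f n edges (n <> 5, 6).
   Otherwise, if G contains a K_4, each outside vertex has at most two
   neighbours in it, so e(G) <= 6 + 2(n - 4) + f(n - 4) = f n; in case of
   equality the pairs of neighbours form two opposite edges of the K_4, which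
   splits G into two sides that induce matchings. Finally, if G is K_4-free,
   every triangle has an edge that lies in no other triangle; deleting the ends
   of such an edge gives e(G) <= floor((n + 1)^2 / 4) - 1 by induction in steps
   of two, and the extremal graphs are joins of a vertex with a balanced complete
   bipartite graph. *)

Set Implicit Arguments.
Unset Strict Implicit.
Unset Printing Implicit Defensive.

(** The value f n is floor((n+1)^2/4), lowered by 1 unless 4 divides n. Joining a vertex to a
    balanced complete bipartite graph gives floor((n+1)^2/4) - 1 edges; two classes with matchings
    gain one more edge only when both can have the even size n/2. The counts for deleting a K_4, and
    for deleting an edge that lies in at most one triangle, remove exactly the increments of f and
    of floor((n+1)^2/4), so equality passes through them and yields structure; deleting five
    vertices loses strictly once n > 6. The exceptions come from K_5, which has too few vertices to
    contain T: it has 10 edges while f 5 = 8, and K_5 with a pendant edge has 11 = f 6 edges. This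
    surplus on five vertices has to be tracked through the induction. All counts concern vertex sets
    [W] of one fixed graph, so that deletion never changes the vertex type. *)

Definition quarter_sq (n : nat) : nat := n.+1 ^ 2 %/ 4.

(** The increment is one edge together with the at most [n.+1] edges that leave it when it has at
    most one common neighbour. *)
Lemma quarter_sqSS n : quarter_sq n.+2 = quarter_sq n + n.+2.
Proof.
rewrite /quarter_sq.
have -> : n.+3 ^ 2 = n.+2 * 4 + n.+1 ^ 2 by lia.
by rewrite divnMDl // addnC.
Qed.

Lemma quarter_sq_gt0 n : 0 < n -> 0 < quarter_sq n.
Proof. by move=> n0; rewrite divn_gt0 // (@leq_exp2r 2 _ 2). Qed.

(* The value of ex(n, T) for n <> 5. *)
Definition turan_T (n : nat) : nat := quarter_sq n - ~~ (4 %| n).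

(** The increment is the six edges of a K_4 and two edges from each of the [n] other vertices. *)
Lemma turan_T4 n : turan_T (4 + n) = turan_T n + n.*2 + 6.
Proof.
rewrite /turan_T !quarter_sqSS dvdn_addr //.
case: n => [|n]; first by rewrite /quarter_sq.
have := quarter_sq_gt0 (ltn0Sn n); lia.
Qed.

Lemma turan_T_mod k :
  [/\ turan_T (4 * k) = 4 * k ^ 2 + 2 * k,
      turan_T (4 * k + 1) = 4 * k ^ 2 + 4 * k,
      turan_T (4 * k + 2) = 4 * k ^ 2 + 6 * k + 1 &
      turan_T (4 * k + 3) = 4 * k ^ 2 + 8 * k + 3].
Proof.
elim: k => [|k [IH0 IH1 IH2 IH3]]; first by rewrite /turan_T /quarter_sq.
have E i : turan_T (4 * k.+1 + i) = turan_T (4 * k + i) + (4 * k + i).*2 + 6.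
  by rewrite mulnS -addnA turan_T4.
have sq : k.+1 ^ 2 = k ^ 2 + k.*2 + 1 by lia.
split; rewrite sq.
- by have := E 0; rewrite !addn0 IH0; lia.
- by rewrite E IH1; lia.
- by rewrite E IH2; lia.
by rewrite E IH3; lia.
Qed.

(** * Counting edges and small cliques *)

Section Counting.

Variables (V : finType) (r : rel V).
Hypotheses (r_sym : symmetric r) (r_irr : irreflexive r).

Definition deg_in (x : V) (A : {set V}) : nat := \sum_(y in A) r x y.
(* Ordered pairs: [arcs W W] is twice the number of edges in [W]. *)
Definition arcs (A B : {set V}) : nat := \sum_(x in A) deg_in x B.

Lemma arcsC A B : arcs A B = arcs B A.
Proof.
rewrite /arcs /deg_in exchange_big; apply: eq_bigr => x _.
by apply: eq_bigr => y _; rewrite r_sym.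
Qed.

Lemma arcs_setD (D W : {set V}) : D \subset W ->
  arcs W W = arcs D D + 2 * arcs (W :\: D) D + arcs (W :\: D) (W :\: D).
Proof.
move=> sDW.
have degE x : deg_in x W = deg_in x D + deg_in x (W :\: D).
  by rewrite /deg_in (big_setID D) (setIidPr sDW).
have -> : arcs W W = arcs D W + arcs (W :\: D) W.
  by rewrite {1}/arcs (big_setID D) (setIidPr sDW).
have arcsE A : arcs A W = arcs A D + arcs A (W :\: D).
  by rewrite /arcs -big_split; apply: eq_bigr => x _; rewrite degE.
rewrite !arcsE (arcsC D (W :\: D)); lia.
Qed.

Lemma deg_in_le x A : deg_in x A <= #|A|.
Proof. by rewrite -sum1_card; apply: leq_sum => y _; apply: leq_b1. Qed.

Lemma arcs_le k (A B : {set V}) :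
  (forall x, x \in A -> deg_in x B <= k) -> arcs A B <= #|A| * k.
Proof.
by move=> H; rewrite -sum_nat_const; apply: leq_sum => x /H.
Qed.

(** Turns equality in a count into structure: a sum that attains its termwise bound attains it in
    every term. *)
Lemma arcs_le_eq k (A B : {set V}) :
  (forall x, x \in A -> deg_in x B <= k) -> arcs A B = #|A| * k ->
  forall x, x \in A -> deg_in x B = k.
Proof.
move=> H E x xA; apply/eqP; rewrite eqn_leq H //=.
move: E; rewrite (cardsD1 x) xA mulSn /arcs (big_setD1 x) //=.
have : \sum_(i in A :\ x) deg_in i B <= #|A :\ x| * k.
  by apply: arcs_le => y; rewrite inE => /andP[_ /H].
lia.
Qed.

Lemma deg_in_self x (A : {set V}) : x \in A -> deg_in x A < #|A|.
Proof.
move=> xA; rewrite (cardsD1 x) xA /deg_in (big_setD1 x) //= r_irr.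
exact: deg_in_le.
Qed.

Lemma arcs_clique_le (A : {set V}) : arcs A A <= #|A| * #|A|.-1.
Proof.
by apply: arcs_le => x /deg_in_self; case: #|A|.
Qed.

Lemma deg_in_seq x (s : seq V) : uniq s ->
  deg_in x [set y in s] = \sum_(y <- s) r x y.
Proof.
by move=> us; rewrite big_uniq //; apply: eq_bigl => y; rewrite inE.
Qed.

Lemma arcs_set2 x y : r x y -> arcs [set x; y] [set x; y] = 2.
Proof.
move=> rxy; have xy : x != y by apply: contraTneq rxy => ->; rewrite r_irr.
rewrite /arcs /deg_in !big_setU1 ?inE //= !big_set1 !big_setU1 ?inE //=.
by rewrite !big_set1 !r_irr (r_sym y) rxy.
Qed.

Lemma arcs_pos (A : {set V}) : 0 < arcs A A ->
  exists x y, [/\ x \in A, y \in A & r x y].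
Proof.
rewrite lt0n /arcs sum_nat_eq0 => /forall_inPn[x xA].
rewrite -lt0n lt0n /deg_in sum_nat_eq0 => /forall_inPn[y yA].
by rewrite eqb0 negbK => rxy; exists x, y.
Qed.

Lemma card_setD_seq (W : {set V}) (s : seq V) : uniq s ->
  {subset s <= W} -> #|W| = size s + #|W :\: [set x in s]|.
Proof.
move=> us sW.
have sub : [set x in s] \subset W by apply/subsetP => x; rewrite inE => /sW.
rewrite -(cardsID [set x in s] W) (setIidPr sub) cardsE.
by rewrite (card_uniqP us).
Qed.

(* No copy of T: triangle [x y z], with [a], [b], [c] erected on [x y], [y z],
   [x z]; the inequalities that adjacency forces are left out. *)
Definition T_free : Prop := forall x y z a b c,
  [&& r x y, r y z & r x z] -> [&& r a x, r a y, r b y, r b z, r c x & r c z] ->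
  [&& a != z, b != x, c != y, a != b, b != c & a != c] -> False.

Definition K4 (w x y z : V) : bool :=
  [&& r w x, r w y, r w z, r x y, r x z & r y z].

(** Adjacency of [u] and [v] is left open, so both K_5 and K_5 minus an edge are covered; [r u v]
    tells them apart. *)
Definition K5minus (x y z u v : V) : bool :=
  [&& [&& r x y, r x z & r y z], [&& r x u, r y u & r z u],
      [&& r x v, r y v & r z v] & u != v].

Lemma adj_neq x y : r x y -> x != y.
Proof. by apply: contraTneq => ->; rewrite r_irr. Qed.

Hypothesis Tfree : T_free.

Lemma K5minus_uniq x y z u v : K5minus x y z u v -> uniq [:: x; y; z; u; v].
Proof.
case/and4P=> /and3P[xy xz yz] /and3P[xu yu zu] /and3P[xv yv zv] uv.
by rewrite /= !inE !negb_or uv !adj_neq.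
Qed.

Lemma K4_uniq w x y z : K4 w x y z -> uniq [:: w; x; y; z].
Proof.
case/and5P=> wx wy wz xy /andP[xz yz].
by rewrite /= !inE !negb_or !adj_neq.
Qed.

Ltac adjacency :=
  do ? [apply/andP; split];
  solve [done | by rewrite r_sym | by rewrite eq_sym].
Ltac T_at x y z a b c := exfalso;
  apply: (@Tfree x y z a b c); adjacency.

(** If [w] is adjacent to both ends of an edge of the five-vertex set, erecting [w] on that edge and
    using the three other vertices gives T. So two neighbours can only be [u] and [v], and only when
    these are not adjacent. *)
Lemma K5minus_deg x y z u v w : K5minus x y z u v ->
  w \notin [:: x; y; z; u; v] ->
  \sum_(t <- [:: x; y; z; u; v]) r w t <= 2 - r u v.
Proof.
move=> K; have := K5minus_uniq K; move: K.
case/and4P=> /and3P[xy xz yz] /and3P[xu yu zu] /and3P[xv yv zv] uv.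
rewrite /= !inE !negb_or -!andbA.
do ! [case/andP => ?]; move=> _; do ! [case/andP => ?]; move=> ?.
have Nxy : ~~ (r w x && r w y) by apply/negP=> /andP[? ?]; T_at x y z w u v.
have Nxz : ~~ (r w x && r w z) by apply/negP=> /andP[? ?]; T_at x z y w u v.
have Nyz : ~~ (r w y && r w z) by apply/negP=> /andP[? ?]; T_at y z x w u v.
have Nxu : ~~ (r w x && r w u) by apply/negP=> /andP[? ?]; T_at x u y w z v.
have Nyu : ~~ (r w y && r w u) by apply/negP=> /andP[? ?]; T_at y u x w z v.
have Nzu : ~~ (r w z && r w u) by apply/negP=> /andP[? ?]; T_at z u x w y v.
have Nxv : ~~ (r w x && r w v) by apply/negP=> /andP[? ?]; T_at x v y w z u.
have Nyv : ~~ (r w y && r w v) by apply/negP=> /andP[? ?]; T_at y v x w z u.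
have Nzv : ~~ (r w z && r w v) by apply/negP=> /andP[? ?]; T_at z v x w y u.
have Nuv : ~~ [&& r w u, r w v & r u v].
  by apply/negP=> /and3P[? ? ?]; T_at u v x w y z.
move: Nxy Nxz Nyz Nxu Nyu Nzu Nxv Nyv Nzv Nuv; rewrite !big_cons big_nil.
by case: (r w x); case: (r w y); case: (r w z); case: (r w u); case: (r w v);
  case: (r u v).
Qed.

Definition K5minus_free (W : {set V}) : Prop :=
  forall x y z u v, {subset [:: x; y; z; u; v] <= W} -> ~~ K5minus x y z u v.

(** With three neighbours in the K_4, [v] and the fourth vertex of the K_4 would be the free pair of
    a [K5minus]. *)
Lemma K4_deg (W : {set V}) w x y z v : K5minus_free W ->
    {subset [:: w; x; y; z] <= W} -> v \in W ->
  K4 w x y z -> v \notin [:: w; x; y; z] ->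
  \sum_(t <- [:: w; x; y; z]) r v t <= 2.
Proof.
move=> K5 sW vW /and5P[wx wy wz xy /andP[xz yz]].
rewrite !inE !negb_or => /and4P[vw vx vy vz].
have N a b c d : {subset [:: a; b; c; d] <= [:: w; x; y; z]} ->
    K4 a b c d -> v != d -> ~~ [&& r v a, r v b & r v c].
  move=> sub /and5P[? ? ? ? /andP[? ?]] ?; apply/negP=> /and3P[? ? ?].
  have /negP[] : ~~ K5minus a b c d v.
    apply: K5 => t; rewrite !inE => H.
    have [->//|tv] := eqVneq t v; apply: sW; apply: sub.
    by move: H; rewrite (negPf tv) orbF !inE.
  by adjacency.
have Nwxy : ~~ [&& r v w, r v x & r v y].
  by apply: (N _ _ _ z); [| rewrite /K4; adjacency|].
have Nwxz : ~~ [&& r v w, r v x & r v z].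
  by apply: (N _ _ _ y); [move=> t; rewrite !inE => /or4P[]/eqP->;
    rewrite eqxx ?orbT | rewrite /K4; adjacency|].
have Nwyz : ~~ [&& r v w, r v y & r v z].
  by apply: (N _ _ _ x); [move=> t; rewrite !inE => /or4P[]/eqP->;
    rewrite eqxx ?orbT | rewrite /K4; adjacency|].
have Nxyz : ~~ [&& r v x, r v y & r v z].
  by apply: (N _ _ _ w); [move=> t; rewrite !inE => /or4P[]/eqP->;
    rewrite eqxx ?orbT | rewrite /K4; adjacency|].
move: Nwxy Nwxz Nwyz Nxyz; rewrite !big_cons big_nil.
by case: (r v w); case: (r v x); case: (r v y); case: (r v z).
Qed.

Lemma arcs_seq (s : seq V) : uniq s ->
  arcs [set x in s] [set x in s] = \sum_(x <- s) \sum_(y <- s) r x y.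
Proof.
move=> us; rewrite [RHS]big_uniq //; apply: eq_big => x; first by rewrite inE.
by rewrite deg_in_seq.
Qed.

Lemma arcs_le_outside k d (W : {set V}) (s : seq V) : uniq s ->
    {subset s <= W} -> arcs [set x in s] [set x in s] <= d ->
    (forall v, v \in W -> v \notin s -> \sum_(t <- s) r v t <= k) ->
  arcs W W <= d + 2 * ((#|W| - size s) * k) +
     arcs (W :\: [set x in s]) (W :\: [set x in s]).
Proof.
move=> us sW arcs_d H; rewrite (arcs_setD (D := [set x in s])); last first.
  by apply/subsetP => x; rewrite inE => /sW.
rewrite (card_setD_seq us sW) addKn leq_add2r leq_add //.
rewrite leq_pmul2l //; apply: arcs_le => v.
by rewrite !inE => /andP[vs vW]; rewrite deg_in_seq // H.
Qed.

Definition K4_free (W : {set V}) : Prop :=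
  forall w x y z, {subset [:: w; x; y; z] <= W} -> ~~ K4 w x y z.

(** * Edges lying in at most one triangle *)

Definition light (W : {set V}) (u v : V) : bool :=
  [forall s in W, forall t in W,
    [&& r u s, r v s, r u t & r v t] ==> (s == t)].

Lemma not_lightP (W : {set V}) u v z : ~~ light W u v ->
  exists2 a, a \in W & [&& r a u, r a v & a != z].
Proof.
case/forall_inPn => s sW /forall_inPn[t tW]; rewrite negb_imply.
case/andP=> /and4P[us vs ut vt] st.
have [E|sz] := eqVneq s z; last by exists s => //; adjacency.
by exists t => //; rewrite -E; adjacency.
Qed.

(** If no edge of a triangle is light, each carries a further triangle; absence of K_4 makes the
    three new apexes distinct, which is a copy of T. *)
Lemma light_edge (W : {set V}) : K4_free W -> 0 < arcs W W ->
  exists u v, [/\ u \in W, v \in W, r u v & light W u v].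
Proof.
move=> K4W /arcs_pos[x [y [xW yW xy]]].
have [l|/(not_lightP x)[z zW /and3P[zx zy _]]] := boolP (light W x y).
  by exists x, y.
have [l|/(not_lightP x)[b bW /and3P[yb zb bx]]] := boolP (light W y z).
  by exists y, z; split=> //; adjacency.
have [l|/(not_lightP y)[c cW /and3P[xc zc cy]]] := boolP (light W x z).
  by exists x, z; split=> //; adjacency.
(* The edge [x y] is tested a second time: the first failure supplied the apex [z], this one
   supplies an apex other than [z]. *)
have [l|/(not_lightP z)[a aW /and3P[xa ya az]]] := boolP (light W x y).
  by exists x, y.
have noK4 t : t \in W -> ~~ [&& r t x, r t y & r t z].
  move=> tW; apply/negP=> /and3P[tx ty tz]; have /negP[] : ~~ K4 x y z t.
    by apply: K4W => v; rewrite !inE => /or4P[]/eqP->.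
  by rewrite /K4; adjacency.
have nab : a != b.
  by apply: contra (noK4 _ aW) => /eqP E; rewrite xa ya E.
have nbc : b != c.
  by apply: contra (noK4 _ bW) => /eqP E; rewrite yb zb E xc.
have nac : a != c.
  by apply: contra (noK4 _ aW) => /eqP E; rewrite xa ya E.
T_at x y z a b c.
Qed.

(** Only a common neighbour sends two edges to the pair, and there is at most one; this is the
    surplus 1 over [#|W'|]. *)
Lemma light_arcs (W : {set V}) u v : r u v -> light W u v ->
  let D := [set u; v] in let W' := W :\: D in
  arcs W' D <= #|W'|.+1 /\
  (arcs W' D = #|W'|.+1 -> exists s, [/\ s \in W', r s u, r s v &
     forall y, y \in W' -> y != s -> r y u (+) r y v]).
Proof.
move=> uv l D W'.
have degD y : deg_in y D = r y u + r y v.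
  by rewrite /deg_in big_setU1 ?inE ?big_set1 // adj_neq.
have [/exists_inP[s sW' /andP[su sv]]|] :=
    boolP [exists s in W', r s u && r s v]; last first.
  move/exists_inPn=> N.
  have le : arcs W' D <= #|W'| * 1.
    apply: arcs_le => y /N; rewrite degD.
    by case: (r y u); case: (r y v).
  by split=> [|E]; lia.
have le1 y : y \in W' :\ s -> deg_in y D <= 1.
  rewrite !inE degD => /and3P[ys _ yW]; move/forall_inP: l => /(_ _ yW).
  have sW : s \in W by case/setDP: sW'.
  move/forall_inP=> /(_ _ sW); rewrite (negPf ys) implybF.
  rewrite (r_sym u y) (r_sym v y) (r_sym u s) (r_sym v s) su sv.
  by case: (r y u); case: (r y v).
have E : arcs W' D = 2 + arcs (W' :\ s) D.
  by rewrite {1}/arcs (big_setD1 s) //= degD su sv.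
have cW : #|W'| = #|W' :\ s|.+1 by rewrite (cardsD1 s) sW'.
have le := arcs_le le1; split; first lia.
move=> Eq; exists s; split=> // y yW ys.
have Eq' : arcs (W' :\ s) D = #|W' :\ s| * 1 by lia.
have := arcs_le_eq le1 Eq' (x := y); rewrite in_setD1 ys yW degD.
by move/(_ isT); case: (r y u); case: (r y v).
Qed.

(** * K_4-free graphs *)

(* [W] induces the join of the vertex [c] with a complete bipartite graph whose
   classes are [A] and its complement in [W :\ c]. *)
Definition cone (W : {set V}) (c : V) (A : {set V}) : Prop :=
  [/\ c \in W, forall x, x \in W :\ c -> r c x,
      forall x y, x \in W :\ c -> y \in W :\ c ->
        r x y = (x \in A) (+) (y \in A) &
      #|(W :\ c) :&: A| <= #|(W :\ c) :\: A|.+1 /\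
      #|(W :\ c) :\: A| <= #|(W :\ c) :&: A|.+1].

Lemma coneC W c A : cone W c A -> cone W c (~: A).
Proof.
case=> cW cx xy [b1 b2]; split=> //.
  by move=> x y xW yW; rewrite xy // !inE; case: (x \in A); case: (y \in A).
by rewrite [_ :\: ~: A]setDE setCK -setDE.
Qed.

(** Here [u] joins the class outside [A] and [v] the class inside, so both grow by one and stay
    balanced. Since [A] is an arbitrary set of which only the trace on [W] matters, it may contain
    [u], which is therefore removed. *)
Lemma cone_add (W : {set V}) u v c A :
    u \in W -> v \in W -> r u v ->
    cone (W :\: [set u; v]) c A -> r c u -> r c v ->
    (forall x, x \in (W :\: [set u; v]) :\ c -> r x u = (x \in A)) ->
    (forall x, x \in (W :\: [set u; v]) :\ c -> r x v = (x \notin A)) ->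
  cone W c (v |: (A :\ u)).
Proof.
move=> uW vW uv [cW cx xyA [b1 b2]] cu cv xu xv.
have nuv := adj_neq uv.
move: cW; rewrite !inE negb_or => /andP[/andP[ncu ncv] cW].
have inW' x : x \in W :\ c -> x != u -> x != v ->
    x \in (W :\: [set u; v]) :\ c.
  by rewrite !inE => /andP[-> ->] /negPf-> /negPf->.
have E1 : (W :\ c) :&: (v |: (A :\ u)) =
    v |: (((W :\: [set u; v]) :\ c) :&: A).
  apply/setP=> x; rewrite !inE.
  have [->|xv'] := eqVneq x v; first by rewrite (eq_sym v c) ncv vW.
  have [->|xu'] := eqVneq x u; first by rewrite !andbF.
  by rewrite /= ?andbT ?andbA.
have E2 : (W :\ c) :\: (v |: (A :\ u)) =
    u |: (((W :\: [set u; v]) :\ c) :\: A).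
  apply/setP=> x; rewrite !inE.
  have [->|xu'] := eqVneq x u; first by rewrite (eq_sym u c) ncu uW (negPf nuv).
  have [->|xv'] := eqVneq x v; first by rewrite /= !andbF.
  by rewrite /= ?andbT ?andbA.
split=> //.
- move=> x xW; have [->//|xv'] := eqVneq x v; have [->//|xu'] := eqVneq x u.
  by apply: cx; apply: inW'.
- have uA : (u \in v |: (A :\ u)) = false by rewrite !inE eqxx (negPf nuv).
  have vA : (v \in v |: (A :\ u)) = true by rewrite !inE eqxx.
  have xA x : x != u -> x != v -> (x \in v |: (A :\ u)) = (x \in A).
    by rewrite !inE => -> /negPf->.
  move=> x y xW yW.
  have [->|xu'] := eqVneq x u; first rewrite uA.
    have [->|yu'] := eqVneq y u; first by rewrite uA r_irr.
    have [->|yv'] := eqVneq y v; first by rewrite vA.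
    by rewrite xA // r_sym xu // inW'.
  have [->|xv'] := eqVneq x v; first rewrite vA.
    have [->|yu'] := eqVneq y u; first by rewrite uA r_sym.
    have [->|yv'] := eqVneq y v; first by rewrite vA r_irr.
    by rewrite xA // r_sym xv // inW'.
  rewrite (xA x) //.
  have [->|yu'] := eqVneq y u; first by rewrite uA addbF xu // inW'.
  have [->|yv'] := eqVneq y v; first by rewrite vA addbT xv // inW'.
  by rewrite xA // xyA // inW'.
rewrite E1 E2 !cardsU1 !inE !eqxx ?orbT ?andbF /=; lia.
Qed.

(** Neighbours of [u] in both classes would form a K_4 with [u] and [c], and likewise for [v]. Each
    neighbourhood thus lies in one class, and together they partition [W' :\ c], so they are the two
    classes. *)
Lemma cone_step_center (W : {set V}) u v c A : K4_free W ->
    u \in W -> v \in W -> r u v ->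
    let W' := W :\: [set u; v] in
    cone W' c A -> r c u -> r c v ->
    (forall y, y \in W' -> y != c -> r y u (+) r y v) ->
  exists A', cone W c A'.
Proof.
move=> K4W uW vW uv W' coneW' cu cv uORv.
have [cW cx xyA [b1 b2]] := coneW'.
suff [H|H] : (forall x, x \in W' :\ c -> r x u = (x \in A)) \/
             (forall x, x \in W' :\ c -> r x v = (x \in A)).
- exists (v |: (A :\ u)); apply: cone_add => // x xW; rewrite -(H _ xW).
  move: xW; rewrite in_setD1 => /andP[xc xW].
  by have := uORv _ xW xc; case: (r x u); case: (r x v).
- exists (u |: (A :\ v)); have vu : r v u by rewrite r_sym.
  apply: cone_add; rewrite // setUC -/W' //.
  move=> x xW; rewrite -(H _ xW).
  move: xW; rewrite in_setD1 => /andP[xc xW].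
  by have := uORv _ xW xc; case: (r x u); case: (r x v).
have W'W x : x \in W' -> x \in W by rewrite inE => /andP[].
have noK4 w a b : w \in W -> r c w -> a \in W' :\ c -> b \in W' :\ c ->
    a \in A -> b \notin A -> ~~ (r a w && r b w).
  move=> wW cw aW bW aA bA; apply/negP=> /andP[aw bw].
  have ca := cx _ aW; have cb := cx _ bW.
  have ab : r a b by rewrite xyA // aA (negPf bA).
  have /negP[] : ~~ K4 w c a b.
    move: aW bW; rewrite !in_setD1 => /andP[_ aW] /andP[_ bW].
    apply: K4W => t; rewrite !inE => /or4P[]/eqP-> //; exact: W'W.
  by rewrite /K4; adjacency.
have xor y : y \in W' :\ c -> r y v = ~~ r y u.
  rewrite in_setD1 => /andP[yc yW].
  by have := uORv _ yW yc; case: (r y u); case: (r y v).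
have in1 (S : {set V}) x y : #|S| <= 1 -> x \in S -> y \in S -> x = y.
  by move=> /card_le1_eqP H xS yS; apply: H.
(* The argument compares a vertex of each class. When a class is empty, balance leaves at most one
   vertex in the other, and the claim is checked directly. *)
have [EA|[a]] := set_0Vmem ((W' :\ c) :&: A).
  have nA x : x \in W' :\ c -> (x \in A) = false.
    by move=> xW; have := in_set0 x; rewrite -EA in_setI xW.
  have [EB|[b]] := set_0Vmem ((W' :\ c) :\: A).
    by left=> x xW; have := in_set0 x; rewrite -EB in_setD xW nA.
  move: (b2); rewrite EA cards0 => /in1 in1B bB.
  have all_b x : x \in W' :\ c -> x = b.
    by move=> xW; apply: in1B => //; rewrite in_setD xW nA.
  have [bu|bu] := boolP (r b u).
    by right=> x xW; rewrite nA // xor // (all_b x) // bu.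
  by left=> x xW; rewrite nA // (all_b x) // (negPf bu).
rewrite in_setI => /andP[aW aA].
have [EB|[b]] := set_0Vmem ((W' :\ c) :\: A).
  have nB x : x \in W' :\ c -> (x \in A).
    by move=> xW; have := in_set0 x; rewrite -EB in_setD xW andbT => /negbFE.
  move: (b1); rewrite EB cards0 => /in1 in1A.
  have all_a x : x \in W' :\ c -> x = a.
    by move=> xW; apply: in1A; rewrite in_setI ?xW ?aW ?nB.
  have [au|au] := boolP (r a u).
    by left=> x xW; rewrite nB // (all_a x).
  by right=> x xW; rewrite nB // xor // (all_a x).
rewrite in_setD => /andP[bA bW].
have [au|au] := boolP (r a u); [left|right] => x xW.
- have bv : ~~ r b u.
    by apply: contra (noK4 u a b uW cu aW bW aA bA) => bu; rewrite au.
  have [xA|xA] := boolP (x \in A).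
    apply: contraTT bv => xu; apply: contraL (noK4 v x b vW cv xW bW xA bA).
    by rewrite !xor // xu => ->.
  apply/negbTE; apply: contra (noK4 u a x uW cu aW xW aA xA) => xu.
  by rewrite au.
- have av : r a v by rewrite xor.
  have bu : r b u.
    have := noK4 v a b vW cv aW bW aA bA; rewrite av /= xor // negbK //.
  have [xA|xA] := boolP (x \in A).
    have := noK4 u x b uW cu xW bW xA bA; rewrite bu andbT => xu.
    by rewrite xor.
  by have := noK4 v a x vW cv aW xW aA xA; rewrite av => /negPf.
Qed.

(* Here [s] is the only vertex of its class, so it is adjacent to all of [W] and
   becomes the centre. *)
Lemma cone_step_side (W : {set V}) u v s c A : K4_free W ->
    u \in W -> v \in W -> r u v ->
    let W' := W :\: [set u; v] in
    cone W' c A -> s \in W' -> s != c -> s \in A ->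
    r s u -> r s v -> r c u -> ~~ r c v ->
    (forall y, y \in W' -> y != s -> r y u (+) r y v) ->
  cone W s [set c; v].
Proof.
move=> K4W uW vW uv W' [cW cx xyA [b1 b2]] sW sc sA su sv cu cv uORv.
have W'E y : (y \in W') = [&& y != u, y != v & y \in W].
  by rewrite !inE negb_or -andbA.
have sWc : s \in W' :\ c by rewrite in_setD1 sc.
have rcs : r c s by apply: cx.
(* Such a [b] adjacent to [u] would form a K_4 with [u], [s] and [c]; hence its neighbour in the
   deleted pair is [v]. *)
have Bfact b : b \in W' :\ c -> b \notin A ->
    [/\ r s b, r c b, ~~ r b u & r b v].
  move=> bWc bA; have rsb : r s b by rewrite xyA // sA (negPf bA).
  have rcb : r c b by apply: cx.
  move: bWc; rewrite in_setD1 => /andP[bc bW].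
  have nbu : ~~ r b u.
    apply/negP=> bu; have /negP[] : ~~ K4 u s c b.
      apply: K4W => t; rewrite !inE.
      by move: sW cW bW; rewrite !W'E => /and3P[_ _ ?] /and3P[_ _ ?]
        /and3P[_ _ ?] /or4P[]/eqP->.
    by rewrite /K4; adjacency.
  split=> //; have := uORv b bW; rewrite (negPf nbu); apply.
  by apply: contraNneq bA => ->.
(* A second vertex [a] of the class of [s] forces, by balance, a vertex [b] in the other class; then
   T appears whether [a] is adjacent to [u] or to [v]. *)
have As a : a \in W' :\ c -> a \in A -> a = s.
  move=> aWc aA; apply/eqP; apply/negPn/negP => nas.
  have [b] : exists b, b \in (W' :\ c) :\: A.
    apply/set0Pn; rewrite -card_gt0 -ltnS; apply: leq_trans b1.
    rewrite (cardsD1 s) (cardsD1 a) !in_setD1 !in_setI sWc sA aWc aA nas.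
    by rewrite addnA.
  rewrite in_setD => /andP[bA bWc].
  have [rsb rcb nbu bv] := Bfact b bWc bA.
  have rca : r c a by apply: cx.
  have rab : r a b by rewrite xyA // aA (negPf bA).
  have nab : a != b by apply: contraNneq bA => <-.
  move: aWc bWc cW; rewrite !in_setD1 !W'E.
  move=> /and4P[nac nau nav aW] /and4P[nbc nbu' nbv bW] /and3P[ncu ncv _].
  have := uORv a; rewrite W'E nau nav aW => /(_ isT nas).
  have [au _|_ /= av] := boolP (r a u); first by T_at u s c v b a.
  by T_at v s b u c a.
have [nsu nsv sW0] : [/\ s != u, s != v & s \in W] by apply/and3P; rewrite -W'E.
have [ncu ncv cW0] : [/\ c != u, c != v & c \in W] by apply/and3P; rewrite -W'E.
have nuv := adj_neq uv.
have inB x : x \in W :\ s -> x != u -> x != v -> x != c ->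
    x \in W' :\ c /\ x \notin A.
  rewrite in_setD1 => /andP[xs xW] xu xv xc.
  have xWc : x \in W' :\ c by rewrite in_setD1 xc W'E xu xv.
  by split=> //; apply: contra xs => /(As _ xWc) ->.
split=> //.
- move=> x xW.
  have [->//|xu] := eqVneq x u; have [->//|xv] := eqVneq x v.
  have [->|xc] := eqVneq x c; first by rewrite r_sym.
  by have [xWc xA] := inB _ xW xu xv xc; case: (Bfact _ xWc xA).
- have adjE x y : x \in W :\ s -> y \in W :\ s -> x \in [set c; v] ->
      r x y = (y \notin [set c; v]).
    move=> xW yW; rewrite !inE => /orP[]/eqP->.
    + have [->|yv] := eqVneq y v; first by rewrite orbT (negPf cv).
      have [->|yc] := eqVneq y c; first by rewrite r_irr.
      have [->|yu] := eqVneq y u; first by rewrite cu.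
      by have [yWc yA] := inB _ yW yu yv yc; case: (Bfact _ yWc yA) => _ ->.
    have [->|yv] := eqVneq y v; first by rewrite orbT r_irr.
    have [->|yc] := eqVneq y c; first by rewrite r_sym (negPf cv).
    have [->|yu] := eqVneq y u; first by rewrite r_sym uv.
    have [yWc yA] := inB _ yW yu yv yc.
    by rewrite r_sym; case: (Bfact _ yWc yA) => _ _ _ ->.
  move=> x y xW yW; have [xcv|xcv] := boolP (x \in [set c; v]).
    by rewrite adjE.
  have [ycv|ycv] := boolP (y \in [set c; v]); first by rewrite r_sym adjE.
  move: xcv ycv; rewrite !inE !negb_or => /andP[xc xv] /andP[yc yv].
  have [->|xu] := eqVneq x u.
    have [->|yu] := eqVneq y u; first by rewrite r_irr.
    have [yWc yA] := inB _ yW yu yv yc.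
    by rewrite r_sym; case: (Bfact _ yWc yA) => _ _ /negPf-> _.
  have [xWc xA] := inB _ xW xu xv xc.
  have [->|yu] := eqVneq y u; first by case: (Bfact _ xWc xA) => _ _ /negPf-> _.
  have [yWc yA] := inB _ yW yu yv yc.
  by rewrite xyA // (negPf xA) (negPf yA).
have EA : (W' :\ c) :&: A = [set s].
  apply/setP=> x; rewrite in_setI in_set1; apply/andP/eqP => [[xW xA]|->].
    exact: As.
  by split.
have E1 : (W :\ s) :&: [set c; v] = [set c; v].
  apply/setIidPr/subsetP=> x; rewrite !inE => /orP[]/eqP->; last first.
    by rewrite vW eq_sym nsv.
  by rewrite cW0 eq_sym sc.
have E2 : (W :\ s) :\: [set c; v] = u |: ((W' :\ c) :\: A).
  apply/setP=> x; have [->|xu] := eqVneq x u.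
    by rewrite !inE uW (negPf nuv) (eq_sym u c) (negPf ncu) (eq_sym u s) nsu eqxx.
  have [->|xv] := eqVneq x v.
    by rewrite !inE !eqxx ?orbT /= ?andbF orbF eq_sym (negPf nuv).
  have [->|xc] := eqVneq x c.
    by rewrite !inE !eqxx /= ?andbF orbF (negPf ncu).
  have [->|xs] := eqVneq x s.
    by rewrite !inE !eqxx sA /= ?andbF orbF (negPf nsu).
  rewrite !inE (negPf xu) (negPf xv) (negPf xc) xs /=.
  apply/idP/andP => [xW|[]//]; split=> //.
  by case: (inB x) => //; rewrite in_setD1 xs.
(* Balance of the old cone with [A] reduced to [s] leaves at most two vertices in the other class;
   with [u] added it has between one and three, which balances the new class of [c] and [v]. *)
move: b2; rewrite EA E1 E2 cards1 cards2 ncv cardsU1 !inE !eqxx ?andbF /=.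
by move: #|_| => k; clear; lia.
Qed.

(** Equality is carried back over one deletion. If the common neighbour [s] is the old centre, it
    stays the centre; otherwise exchanging the classes, and [u] with [v], makes [s] lie in the first
    class and [c] adjacent to [u] only. *)
Lemma cone_step (W : {set V}) u v s c A : K4_free W ->
    u \in W -> v \in W -> r u v ->
    let W' := W :\: [set u; v] in
    s \in W' -> r s u -> r s v ->
    (forall y, y \in W' -> y != s -> r y u (+) r y v) ->
  cone W' c A -> exists c' A', cone W c' A'.
Proof.
move=> K4W uW vW uv W' sW' su sv uORv coneW'.
have [sc|sc] := eqVneq s c.
  subst s; exists c; apply: (cone_step_center (u := u) (v := v)) => //.
  exact: coneW'.
have cW' : c \in W' by case: coneW'.
have W'E y : (y \in W') = [&& y != u, y != v & y \in W].
  by rewrite !inE negb_or -andbA.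
have [B [sB coneB]] : exists B : {set V}, s \in B /\ cone W' c B.
  have [sA|sA] := boolP (s \in A); first by exists A.
  by exists (~: A); rewrite inE sA; split=> //; apply: coneC.
have ncs : c != s by rewrite eq_sym.
exists s; case: (boolP (r c u)) (uORv c cW' ncs) => [cu /= cv|ncu /= cv].
  by exists [set c; v]; apply: (cone_step_side (u := u) (c := c) (A := B)).
exists [set c; u]; apply: (cone_step_side (u := v) (c := c) (A := B)) => //.
- by rewrite r_sym.
- by rewrite setUC.
- by rewrite setUC.
- by rewrite setUC => y yW ys; rewrite addbC; apply: uORv.
Qed.

Lemma K4_freeS (A B : {set V}) : A \subset B -> K4_free B -> K4_free A.
Proof. by move=> /subsetP sAB K w x y z sA; apply: K => t /sA /sAB. Qed.

(** Deleting a light edge removes at most [#|W'| + 2] edges, the increment in [quarter_sqSS], so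
    equality for [W] forces it for [W'] and in [light_arcs]. The [+ 2] on the left is one edge
    counted twice. The empty set is excluded because [quarter_sq 0 = 0]. *)
Lemma K4_free_arcs (W : {set V}) : K4_free W -> 0 < #|W| ->
  arcs W W + 2 <= 2 * quarter_sq #|W| /\
  (arcs W W + 2 = 2 * quarter_sq #|W| -> exists c A, cone W c A).
Proof.
have [n] := ubnP #|W|; elim: n W => // n IH W Wn K4W W0.
have q2 m : 1 < m -> 1 < quarter_sq m.
  by case: m => [|[|m]] // _; rewrite quarter_sqSS; lia.
have [E0|] := posnP (arcs W W).
  have q0 := quarter_sq_gt0 W0; rewrite E0; split; first lia.
  have [/q2|W1] := ltnP 1 #|W|; first lia.
  have /cards1P[c ->] : #|W| == 1 by rewrite eqn_leq W1.
  exists c, set0; split; rewrite ?set11 // ?setDv.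
  - by move=> x; rewrite inE.
  - by move=> x y; rewrite inE.
  - by rewrite !(setI0, set0D) cards0.
case/(light_edge K4W) => u [v [uW vW uv luv]].
have sD : [set u; v] \subset W by apply/subsetP=> x; rewrite !inE => /orP[]/eqP->.
have nuv := adj_neq uv.
have cD : #|W| = #|W :\: [set u; v]|.+2.
  by rewrite -(cardsID [set u; v] W) (setIidPr sD) cards2 nuv.
have [le eq] := light_arcs uv luv.
rewrite (arcs_setD sD) arcs_set2 // cD quarter_sqSS.
have [W'0|W'0] := posnP #|W :\: [set u; v]|.
  move/eqP: (W'0); rewrite cards_eq0 => /eqP ->.
  rewrite /arcs !big_set0 cards0; split=> // _.
  have -> : W = [set u; v].
    by apply/eqP; rewrite eqEsubset sD andbT -setD_eq0 -cards_eq0 W'0.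
  exists u, [set v].
  have E : [set u; v] :\ u = [set v].
    apply/setP=> x; rewrite !inE; have [->|//] := eqVneq x u.
    by rewrite (negPf nuv).
  split; rewrite ?E ?setIid ?setDv ?cards0 ?cards1 ?inE ?eqxx //.
    by move=> x /set1P->.
  by move=> x y /set1P-> /set1P->; rewrite r_irr !inE eqxx.
have [||bW' coneW'] := IH (W :\: [set u; v]) _ _ W'0.
- by move: Wn; rewrite cD; lia.
- by apply: K4_freeS K4W; apply: subsetDl.
split; first lia.
move=> E; have {eq} [|s [sW su sv uORv]] := eq; first lia.
have {coneW'} [|c [A coneW']] := coneW'; first lia.
exact: (cone_step K4W uW vW uv sW su sv uORv coneW').
Qed.

(** * Graphs containing K_4 *)

Lemma K4_freeVex (W : {set V}) : K4_free W \/
  exists w x y z, {subset [:: w; x; y; z] <= W} /\ K4 w x y z.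
Proof.
have [H|H] := boolP [exists w in W, exists x in W, exists y in W,
  exists z in W, K4 w x y z].
  right; case/exists_inP: H => w ? /exists_inP[x ?].
  move=> /exists_inP[y ?] /exists_inP[z ?] K; exists w, x, y, z; split=> // t.
  by rewrite !inE => /or4P[]/eqP->.
left=> w x y z sW; apply: contra H => K.
apply/exists_inP; exists w; first by rewrite sW // !inE eqxx.
apply/exists_inP; exists x; first by rewrite sW // !inE eqxx ?orbT.
apply/exists_inP; exists y; first by rewrite sW // !inE eqxx ?orbT.
by apply/exists_inP; exists z; first by rewrite sW // !inE eqxx ?orbT.
Qed.

(** The parameter [b] selects the kind searched for: K_5 for [true], K_5 minus an edge for
    [false]. *)
Lemma K5minus_freeVex (b : bool) (W : {set V}) :
  (forall x y z u v, {subset [:: x; y; z; u; v] <= W} ->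
     K5minus x y z u v -> r u v != b) \/
  exists x y z u v, [/\ {subset [:: x; y; z; u; v] <= W},
    K5minus x y z u v & r u v = b].
Proof.
have [H|H] := boolP [exists x in W, exists y in W, exists z in W,
  exists u in W, exists v in W, K5minus x y z u v && (r u v == b)].
  right; case/exists_inP: H => x ? /exists_inP[y ?].
  move=> /exists_inP[z ?] /exists_inP[u ?] /exists_inP[v ?] /andP[K /eqP uv].
  exists x, y, z, u, v; split=> // t.
  by rewrite !inE => /or4P[|||/orP[]]/eqP->.
left=> x y z u v sW K; apply: contra H => uv.
apply/exists_inP; exists x; first by rewrite sW // !inE eqxx.
apply/exists_inP; exists y; first by rewrite sW // !inE eqxx ?orbT.
apply/exists_inP; exists z; first by rewrite sW // !inE eqxx ?orbT.
apply/exists_inP; exists u; first by rewrite sW // !inE eqxx ?orbT.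
apply/exists_inP; exists v; first by rewrite sW // !inE eqxx ?orbT.
by rewrite K uv.
Qed.

Lemma K5minus_freeS (A B : {set V}) :
  A \subset B -> K5minus_free B -> K5minus_free A.
Proof. by move=> /subsetP sAB K x y z u v sA; apply: K => t /sA /sAB. Qed.

Lemma K4_arcs_le (W : {set V}) w x y z (D := [set t in [:: w; x; y; z]]) :
    K5minus_free W -> {subset [:: w; x; y; z] <= W} -> K4 w x y z ->
  arcs W W <= 12 + 2 * ((#|W| - 4) * 2) + arcs (W :\: D) (W :\: D).
Proof.
move=> K5W sW K; have us := K4_uniq K.
apply: (arcs_le_outside (s := [:: w; x; y; z])) => // [|v vW vs];
  last exact: K4_deg sW vW K vs.
by apply: leq_trans (arcs_clique_le _) _; rewrite !cardsE (card_uniqP us).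
Qed.

Lemma K5minus_free_arcs (W : {set V}) :
  K5minus_free W -> arcs W W <= 2 * turan_T #|W|.
Proof.
have [n] := ubnP #|W|; elim: n W => // n IH W Wn K5W.
have [K4W|[w [x [y [z [sW K]]]]]] := K4_freeVex W.
  have [W0|W0] := posnP #|W|.
    by move/eqP: (W0); rewrite cards_eq0 => /eqP ->; rewrite /arcs big_set0.
  have [le _] := K4_free_arcs K4W W0; rewrite /turan_T.
  by move: le; case: (4 %| _) => /=; lia.
apply: leq_trans (K4_arcs_le K5W sW K) _.
have cW := card_setD_seq (K4_uniq K) sW; rewrite /= in cW.
move: cW; set W' := W :\: _ => cW.
have le : arcs W' W' <= 2 * turan_T #|W'|.
  apply: IH; last by apply: K5minus_freeS K5W; apply: subsetDl.
  by move: Wn; rewrite cW; lia.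
rewrite cW turan_T4; lia.
Qed.

(** * Deleting a K_5 or a K_5 minus an edge *)

Lemma K5minus_arcs x y z u v : K5minus x y z u v ->
  arcs [set t in [:: x; y; z; u; v]] [set t in [:: x; y; z; u; v]] =
  18 + 2 * r u v.
Proof.
move=> K; rewrite arcs_seq ?K5minus_uniq //; move: K.
case/and4P=> /and3P[xy xz yz] /and3P[xu yu zu] /and3P[xv yv zv] _.
rewrite !big_cons !big_nil !r_irr (r_sym y x) (r_sym z x) (r_sym z y).
rewrite !(r_sym u x) !(r_sym u y) !(r_sym u z) !(r_sym v x) !(r_sym v y).
rewrite !(r_sym v z) (r_sym v u) xy xz yz xu yu zu xv yv zv.
by case: (r u v).
Qed.

Lemma K5minus_arcs_le (W : {set V}) x y z u v
    (D := [set t in [:: x; y; z; u; v]]) :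
    {subset [:: x; y; z; u; v] <= W} -> K5minus x y z u v ->
  arcs W W <= 18 + 2 * r u v + 2 * ((#|W| - 5) * (2 - r u v)) +
    arcs (W :\: D) (W :\: D).
Proof.
move=> sW K; apply: (arcs_le_outside (s := [:: x; y; z; u; v])) => // [||t tW ts].
- exact: K5minus_uniq K.
- by rewrite K5minus_arcs.
- exact: K5minus_deg K ts.
Qed.

(** Since f(m+5) = f(m+1) + 2m + 8, deleting a K_5 minus an edge, which costs at most 9 + 2m edges,
    is strict as soon as f grows by more than 1 from [m] to [m.+1]; the term [m == 5] pays for the
    surplus on five remaining vertices. *)
Lemma turan_TS m : 1 < m -> turan_T m + 1 + (m == 5) < turan_T m.+1.
Proof.
move=> m1; have [t0 t1 t2 t3] := turan_T_mod (m %/ 4).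
have [t4 _ _ _] := turan_T_mod (m %/ 4).+1.
move: (divn_eq m 4) m1 (ltn_pmod m (isT : 0 < 4)).
set k := m %/ 4 in t0 t1 t2 t3 t4 *.
have sq : k.+1 ^ 2 = k ^ 2 + k.*2 + 1 by lia.
case: (m %% 4) => [|[|[|[|//]]]] -> m1 _; rewrite ?addn0 mulnC ?t0 ?t1 ?t2 ?t3.
- have -> : (4 * k).+1 = 4 * k + 1 by lia.
  rewrite t1; lia.
- have -> : (4 * k + 1).+1 = 4 * k + 2 by lia.
  rewrite t2; lia.
- have -> : (4 * k + 2).+1 = 4 * k + 3 by lia.
  rewrite t3; lia.
have -> : (4 * k + 3).+1 = 4 * k.+1 by lia.
rewrite t4; lia.
Qed.

(** On five vertices K_5 minus an edge has one edge more than f 5. K_5 is excluded at this stage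
    because the deletion could otherwise leave a K_5 behind, and 9 + 10 + 10 = 29 = f 10 would not
    be strict. *)
Lemma K5_free_arcs (W : {set V}) :
    (forall x y z u v, {subset [:: x; y; z; u; v] <= W} ->
       K5minus x y z u v -> r u v != true) ->
  arcs W W <= 2 * turan_T #|W| + 2 * (#|W| == 5) /\
  (~ K5minus_free W -> #|W| <> 5 -> #|W| <> 6 -> arcs W W < 2 * turan_T #|W|).
Proof.
have [n] := ubnP #|W|; elim: n W => // n IH W Wn K5W.
have [noK5m|[x [y [z [u [v [sW K uv]]]]]]] := K5minus_freeVex false W.
  have free : K5minus_free W.
    move=> x y z u v sW; apply/negP=> K.
    by move: (K5W _ _ _ _ _ sW K) (noK5m _ _ _ _ _ sW K); case: (r u v).
  split=> [|/(_ free)//].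
  exact: leq_trans (K5minus_free_arcs free) (leq_addr _ _).
have le := K5minus_arcs_le sW K.
have cW := card_setD_seq (K5minus_uniq K) sW; rewrite /= in cW.
move: le cW; set W' := W :\: _; rewrite uv => le cW.
have [|x0 y0 z0 u0 v0 sW0|leW' _] := IH W' _ _; first lia.
  by apply: K5W => t /sW0; apply/subsetP/subsetDl.
have E : turan_T #|W| = turan_T #|W'|.+1 + #|W'|.*2 + 8.
  rewrite cW -[5 + _]/(4 + #|W'|.+1) turan_T4; lia.
move: le leW' E; rewrite cW.
have [W'1|] := ltnP 1 #|W'|.
  move: (turan_TS W'1) => /=; move: #|W'| (arcs W' W') => m a; clear; lia.
(* With at most one vertex left, [W] has five or six vertices, where the count gives f 5 + 1 = 9 and
   f 6 = 11 edges: strictness fails exactly here. *)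
have [t0 t1 t2] : [/\ turan_T 0 = 0, turan_T 1 = 0 & turan_T 2 = 1] by [].
move: #|W'| (arcs W' W') => [|[|//]] a _; rewrite ?t0 ?t1 ?t2; clear; lia.
Qed.

(** The surplus 4 is the two edges by which K_5 exceeds f 5, counted twice. A vertex outside a K_5
    has at most one neighbour in it, which leaves enough slack to put no condition on the remaining
    vertices. *)
Lemma T_free_arcs (W : {set V}) :
  arcs W W <= 2 * turan_T #|W| + 4 * (#|W| == 5) /\
  (~ K5minus_free W -> #|W| <> 5 -> #|W| <> 6 -> arcs W W < 2 * turan_T #|W|).
Proof.
have [n] := ubnP #|W|; elim: n W => // n IH W Wn.
have [noK5|[x [y [z [u [v [sW K uv]]]]]]] := K5minus_freeVex true W.
  have [le lt] := K5_free_arcs noK5.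
  by split=> //; apply: leq_trans le _; rewrite leq_add2l leq_mul2r orbT.
have le := K5minus_arcs_le sW K.
have cW := card_setD_seq (K5minus_uniq K) sW; rewrite /= in cW.
move: le cW; set W' := W :\: _; rewrite uv => le cW.
have [|leW' _] := IH W' _; first lia.
have E : turan_T #|W| = turan_T #|W'|.+1 + #|W'|.*2 + 8.
  rewrite cW -[5 + _]/(4 + #|W'|.+1) turan_T4; lia.
move: le leW' E; rewrite cW.
have [W'1|] := ltnP 1 #|W'|.
  move: (turan_TS W'1) => /=; move: #|W'| (arcs W' W') => m a; clear; lia.
have [t0 t1 t2] : [/\ turan_T 0 = 0, turan_T 1 = 0 & turan_T 2 = 1] by [].
move: #|W'| (arcs W' W') => [|[|//]] a _; rewrite ?t0 ?t1 ?t2; clear; lia.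
Qed.

(** * The equality case around a K_4 *)

Definition two_matchings (X : {set V}) : Prop :=
  forall x y z, (x \in X) = (y \in X) -> (x \in X) = (z \in X) ->
    r x y -> r x z -> y = z.

Definition opposite (w x y z v : V) : bool :=
  [&& v \notin [:: w; x; y; z], r v w, r v x, ~~ r v y & ~~ r v z].

(** In [S] the vertices [y] and [z] see only each other. A vertex [a] of [S] off the K_4 has only
    such vertices as neighbours in [S]; two of them, erected on [a x] and [a w], with [y] erected on
    [w x], give T. *)
Lemma opposite_matching w x y z
    (S := fun v => [|| v == y, v == z | opposite w x y z v]) :
  K4 w x y z -> forall a b c, S a -> S b -> S c -> r a b -> r a c -> b = c.
Proof.
move=> K a b c; rewrite /S => Sa Sb Sc ab ac; apply/eqP/negPn/negP => nbc.
move: (K) => /and5P[wx wy wz xy /andP[xz yz]].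
have := K4_uniq K.
rewrite /= !inE !negb_or -!andbA => /and5P[? ? ? ? /and3P[? ? _]].
case/or3P: Sa ab ac => [/eqP->|/eqP->|Oa] ab ac.
- case/or3P: Sb ab => [/eqP->|/eqP Eb|/and5P[_ _ _ /negPf by_ _]] ab.
  + by rewrite r_irr in ab.
  + case/or3P: Sc ac => [/eqP->|/eqP Ec|/and5P[_ _ _ /negPf cy _]] ac.
    * by rewrite r_irr in ac.
    * by rewrite Eb Ec eqxx in nbc.
    * by rewrite r_sym cy in ac.
  + by rewrite r_sym by_ in ab.
- case/or3P: Sb ab => [/eqP Eb|/eqP->|/and5P[_ _ _ _ /negPf bz]] ab.
  + case/or3P: Sc ac => [/eqP Ec|/eqP->|/and5P[_ _ _ _ /negPf cz]] ac.
    * by rewrite Eb Ec eqxx in nbc.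
    * by rewrite r_irr in ac.
    * by rewrite r_sym cz in ac.
  + by rewrite r_irr in ab.
  + by rewrite r_sym bz in ab.
case/and5P: Oa; rewrite !inE !negb_or => /and4P[? ? ? ?] aw ax nay naz.
have opp t : [|| t == y, t == z | opposite w x y z t] -> r a t ->
    [/\ r t w, r t x, t != y, t != w & t != x].
  case/or3P => [/eqP->|/eqP->|/and5P[]]; rewrite ?(negPf nay) ?(negPf naz) //.
  by rewrite !inE !negb_or => /and4P[? ? ? ?] ? ?.
have [bw bx nby nbw nbx] := opp b Sb ab.
have [cw cx ncy ncw ncx] := opp c Sc ac.
by T_at w x a y b c.
Qed.

Lemma K4_two_matchings w x y z : K4 w x y z ->
    (forall v, v \notin [:: w; x; y; z] ->
       opposite w x y z v || opposite y z w x v) ->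
  two_matchings [set v | [|| v == y, v == z | opposite w x y z v]].
Proof.
move=> K opp.
have K' : K4 y z w x.
  by case/and5P: K => ? ? ? ? /andP[? ?]; rewrite /K4; adjacency.
have outE v : v \notin [set v | [|| v == y, v == z | opposite w x y z v]] ->
    [|| v == w, v == x | opposite y z w x v].
  rewrite inE !negb_or => /and3P[vy vz vo].
  have [//|vw] := boolP (v == w); have [//|vx] := boolP (v == x).
  have := opp v; rewrite (negPf vo) !inE (negPf vw) (negPf vx) (negPf vy).
  by rewrite (negPf vz); apply.
move=> a b c; have [aX|aX] := boolP (a \in _) => /esym bX /esym cX.
  by move: aX bX cX; rewrite !inE; apply: opposite_matching K a b c.
by apply: (opposite_matching K'); apply: outE; rewrite ?bX ?cX.
Qed.

(* Two pairs sharing one vertex would span with the K4 a copy of T. *)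
Lemma popular_pairs w x y z p q : K4 w x y z ->
    p \notin [:: w; x; y; z] -> \sum_(t <- [:: w; x; y; z]) r p t = 2 ->
    q \notin [:: w; x; y; z] -> \sum_(t <- [:: w; x; y; z]) r q t = 2 ->
    r p w -> r p x ->
  opposite w x y z q || opposite y z w x q.
Proof.
move=> K pD p2 qD q2 pw px.
have qD' : q \notin [:: y; z; w; x].
  by move: qD; rewrite !inE !negb_or => /and4P[-> -> -> ->].
rewrite /opposite qD qD' /=.
have := K4_uniq K; rewrite /= !inE !negb_or -!andbA.
case/and5P=> ? ? ? ? /and3P[? ? _].
move: K => /and5P[wx wy wz xy /andP[xz yz]].
have [py pz] : ~~ r p y /\ ~~ r p z.
  move: p2; rewrite !big_cons big_nil pw px.
  by case: (r p y); case: (r p z).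
move: pD qD; rewrite !inE !negb_or => /and4P[? ? ? ?] /and4P[? ? ? ?].
have npq t : r q t -> ~~ r p t -> p != q by move=> qt; apply: contraNneq => ->.
have nwy : ~~ (r q w && r q y).
  by apply/negP=> /andP[? qy]; have := npq _ qy py => ?; T_at x w y p q z.
have nwz : ~~ (r q w && r q z).
  by apply/negP=> /andP[? qz]; have := npq _ qz pz => ?; T_at x w z p q y.
have nxy : ~~ (r q x && r q y).
  by apply/negP=> /andP[? qy]; have := npq _ qy py => ?; T_at w x y p q z.
have nxz : ~~ (r q x && r q z).
  by apply/negP=> /andP[? qz]; have := npq _ qz pz => ?; T_at w x z p q y.
move: q2 nwy nwz nxy nxz; rewrite !big_cons big_nil.
by case: (r q w); case: (r q x); case: (r q y); case: (r q z).
Qed.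

(** Equality in the count leaves every vertex outside the K_4 with exactly two neighbours in it,
    which is what [popular_pairs] asks for. *)
Lemma K4_extremal w x y z : K5minus_free setT -> K4 w x y z ->
  arcs setT setT = 2 * turan_T #|V| -> exists X, two_matchings X.
Proof.
move=> K5 K E; set s := [:: w; x; y; z].
have sT : {subset s <= [set: V]} by move=> t _; rewrite inE.
have us : uniq s := K4_uniq K.
have deg2 v : v \notin s -> \sum_(t <- s) r v t = 2.
  move=> vs; rewrite -deg_in_seq //.
  have le t : t \in setT :\: [set t in s] -> deg_in t [set t in s] <= 2.
    rewrite !inE andbT deg_in_seq // => ts.
    by apply: (K4_deg K5 sT (in_setT t) K); rewrite !inE.
  apply: (arcs_le_eq le); last by rewrite in_setD in_setT andbT in_set.
  apply/eqP; rewrite eqn_leq arcs_le //=.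
  have cT := card_setD_seq us sT; move: E.
  have sub : [set t in s] \subset setT by apply: subsetT.
  rewrite (arcs_setD sub) -cardsT cT /= turan_T4.
  have := K5minus_free_arcs (K5minus_freeS (subsetT (setT :\: [set t in s])) K5).
  have := arcs_clique_le [set t in s]; rewrite !cardsE (card_uniqP us) /=.
  move: (arcs _ _) (arcs _ _) (arcs _ _) => ? ? ?; clear; lia.
have [/forallP sV|] := boolP [forall v, v \in s].
  exists [set v | [|| v == y, v == z | opposite w x y z v]].
  by apply: K4_two_matchings => // v; rewrite sV.
case/forallPn => p ps.
(* One outside vertex [p] decides which of the three splittings of the K_4 into opposite edges is
   used; the vertices are renamed so that the neighbours of [p] come first, whence the six cases
   below. *)
have pair w' x' y' z' : K4 w' x' y' z' -> s =i [:: w'; x'; y'; z'] ->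
    r p w' -> r p x' -> exists X, two_matchings X.
  move=> K' /(uniq_perm us (K4_uniq K')) eqs pw px.
  exists [set v | [|| v == y', v == z' | opposite w' x' y' z' v]].
  have mems v : (v \in [:: w'; x'; y'; z']) = (v \in s) by rewrite (perm_mem eqs).
  apply: K4_two_matchings => // q; rewrite mems => qs.
  by apply: (popular_pairs (p := p)); rewrite ?mems -?(perm_big _ eqs) //= deg2.
have := deg2 p ps; rewrite /s !big_cons big_nil.
move: (K) => /and5P[wx wy wz xy /andP[xz yz]].
have [pw|_] := boolP (r p w).
  have [px|_] := boolP (r p x); first by move=> _; apply: (pair w x y z).
  have [py|_] := boolP (r p y).
    move=> _; apply: (pair w y x z) => //; first by rewrite /K4; adjacency.
    by move=> t; rewrite !inE; case: (t == w); case: (t == x); case: (t == y);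
    case: (t == z).
  have [pz|//] := boolP (r p z).
  move=> _; apply: (pair w z x y) => //; first by rewrite /K4; adjacency.
  by move=> t; rewrite !inE; case: (t == w); case: (t == x); case: (t == y);
    case: (t == z).
have [px|_] := boolP (r p x).
  have [py|_] := boolP (r p y).
    move=> _; apply: (pair x y w z) => //; first by rewrite /K4; adjacency.
    by move=> t; rewrite !inE; case: (t == w); case: (t == x); case: (t == y);
    case: (t == z).
  have [pz|//] := boolP (r p z).
  move=> _; apply: (pair x z w y) => //; first by rewrite /K4; adjacency.
  by move=> t; rewrite !inE; case: (t == w); case: (t == x); case: (t == y);
    case: (t == z).
have [py|_] := boolP (r p y); last by case: (r p z).
have [pz|//] := boolP (r p z).
move=> _; apply: (pair y z w x) => //; first by rewrite /K4; adjacency.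
by move=> t; rewrite !inE; case: (t == w); case: (t == x); case: (t == y);
    case: (t == z).
Qed.

(** * Edge counts of matchings and cones *)

(** In the equality case the list puts partners at positions 2k and 2k+1 and a possible unmatched
    vertex last, the convention of [matching_rel]. *)
Lemma matching_arcs (A : {set V}) :
    (forall x y z, x \in A -> y \in A -> z \in A -> r x y -> r x z -> y = z) ->
  arcs A A <= 2 * #|A|./2 /\
  (arcs A A = 2 * #|A|./2 -> exists s, [/\ uniq s, s =i A &
     forall x0 i j, i < size s -> j < size s ->
       r (nth x0 s i) (nth x0 s j) = (i != j) && (i./2 == j./2)]).
Proof.
have [n] := ubnP #|A|; elim: n A => // n IH A An matchA.
have [E0|] := posnP (arcs A A).
  rewrite E0; split=> // A1.
  exists (enum A); split=> [||x0 i j]; [exact: enum_uniq|exact: mem_enum|].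
  rewrite -cardE => i_lt j_lt.
  have [-> ->] : i = 0 /\ j = 0 by move: A1 i_lt j_lt; clear; lia.
  by rewrite r_irr.
case/arcs_pos=> x [y [xA yA xy]].
have nxy := adj_neq xy.
have sD : [set x; y] \subset A by apply/subsetP=> t; rewrite !inE => /orP[]/eqP->.
have cA : #|A| = #|A :\: [set x; y]|.+2.
  by rewrite -(cardsID [set x; y] A) (setIidPr sD) cards2 nxy.
move: cA; set A' := A :\: _ => cA.
have sA' t : t \in A' -> [/\ t \in A, t != x & t != y].
  by rewrite !inE negb_or => /andP[/andP[-> ->] ->].
have A'xy t : t \in A' -> r t x = false /\ r t y = false.
  case/sA' => tA tx ty; split; apply/negP=> H.
    by rewrite (matchA x t y) ?eqxx // r_sym in ty.
  by rewrite (matchA y t x) ?eqxx // r_sym // in tx.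
have arcsD : arcs A' [set x; y] = 0.
  apply/eqP; rewrite sum_nat_eq0; apply/forall_inP=> t /A'xy[tx ty].
  by rewrite /deg_in big_setU1 ?inE // big_set1 tx ty.
have [||leA' eqA'] := IH A'.
- by move: An; rewrite cA; clear; lia.
- by move=> t u v /sA'[? _ _] /sA'[? _ _] /sA'[? _ _]; apply: matchA.
rewrite (arcs_setD sD) -/A' arcs_set2 // arcsD cA; split.
  by move: leA'; clear; rewrite /=; lia.
move=> E; have [|s [us sA nths]] := eqA'.
  by move: E; clear; rewrite /=; lia.
have xs : x \notin s by rewrite sA !inE eqxx.
have ys : y \notin s by rewrite sA !inE eqxx orbT.
exists [:: x, y & s]; split=> [|t|x0].
- by rewrite /= !inE negb_or nxy xs ys us.
- rewrite !inE sA !inE; have [->|tx] := eqVneq t x; first by rewrite xA.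
  by have [->|ty] := eqVneq t y; first by rewrite yA.
have nth_in k : k < size s -> nth x0 s k \in A' by move=> ks; rewrite -sA mem_nth.
case=> [|[|i]] [|[|j]] //=; rewrite ?r_irr ?xy ?(r_sym y x) ?xy // !ltnS => H1 H2.
- by rewrite r_sym; case: (A'xy _ (nth_in _ H2)).
- by rewrite r_sym; case: (A'xy _ (nth_in _ H2)).
- by case: (A'xy _ (nth_in _ H1)).
- by case: (A'xy _ (nth_in _ H1)).
by rewrite nths.
Qed.

Lemma cone_arcs W c A : cone W c A -> arcs W W + 2 = 2 * quarter_sq #|W|.
Proof.
case=> cW cx xyA.
have c1W : [set c] \subset W by rewrite sub1set.
rewrite (arcs_setD c1W) (cardsD1 c W) cW.
set W' := W :\ c in cx xyA *.
have -> : arcs [set c] [set c] = 0 by rewrite /arcs /deg_in !big_set1 r_irr.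
have -> : arcs W' [set c] = #|W'|.
  rewrite -sum1_card; apply: eq_bigr => x xW.
  by rewrite /deg_in big_set1 r_sym cx.
have sub : W' :&: A \subset W' by apply: subsetIl.
have EI : W' :\: (W' :&: A) = W' :\: A by rewrite setDIr setDv set0U.
rewrite (arcs_setD sub) EI -(cardsID A W').
have const (B C : {set V}) b : B \subset W' -> C \subset W' ->
    (forall x y, x \in B -> y \in C -> (x \in A) (+) (y \in A) = b) ->
    arcs B C = #|B| * (#|C| * b).
  move=> /subsetP sB /subsetP sC H; rewrite -sum_nat_const.
  apply: eq_bigr => x xB; rewrite -sum_nat_const; apply: eq_bigr => y yC.
  by rewrite xyA; [rewrite (H x y) | exact: sB | exact: sC].
rewrite (const (W' :&: A) (W' :&: A) false) ?subsetIl //; last first.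
  by move=> x y /setIP[_ ->] /setIP[_ ->].
rewrite (const (W' :\: A) (W' :\: A) false) ?subsetDl //; last first.
  by move=> x y /setDP[_ /negPf->] /setDP[_ /negPf->].
rewrite (const (W' :\: A) (W' :&: A) true) ?subsetIl ?subsetDl //; last first.
  by move=> x y /setDP[_ /negPf->] /setIP[_ ->].
rewrite /= !muln0 !muln1.
move: #|_ :&: _| #|_ :\: _| => a b; clear.
wlog le_ab : a b / a <= b.
  move=> H [ab ba]; have [le|/ltnW le] := leqP a b; first exact: H.
  by rewrite (addnC a b) (mulnC b a) H.
case=> _ ba; have [->|->] : b = a \/ b = a.+1 by lia.
  have -> : 1 + (a + a) = a.*2.+1 by lia.
  elim: a {le_ab ba} => [//|a IHa]; rewrite doubleS quarter_sqSS; lia.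
have -> : 1 + (a + a.+1) = a.*2.+2 by lia.
elim: a {le_ab ba} => [//|a IHa]; rewrite doubleS quarter_sqSS; lia.
Qed.

End Counting.

(** * The extremal graphs *)

Section TFree.

Variables (V : finType) (r : rel V).
Hypotheses (r_sym : symmetric r) (r_irr : irreflexive r).

(** Some two vertices [x], [y] of the central triangle share a side. They are each other's partners
    there, so the third vertex [z] and the apexes over [y z] and [x z] all lie on the other side,
    where [z] would have two partners. *)
Lemma two_matchings_T_free X : two_matchings r X -> T_free r.
Proof.
move=> M; have side x y z b c : (x \in X) = (y \in X) ->
    r x y -> r x z -> r y z -> [&& r b y, r b z, r c x & r c z] ->
    b != x -> c != y -> b != c -> False.
  move=> sxy xy xz yz /and4P[yb zb xc zc] bx cy bc.
  rewrite r_sym in yb; rewrite r_sym in zb.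
  rewrite r_sym in xc; rewrite r_sym in zc.
  have yx : r y x by rewrite r_sym.
  have sz : (z \in X) != (x \in X).
    apply/eqP=> sz; move: yz.
    by rewrite (M x y z sxy (esym sz) xy xz) r_irr.
  have sb : (b \in X) = (z \in X).
    apply/eqP/negPn/negP=> sb; have E : (b \in X) = (y \in X).
      by move: sb sz sxy; do 4! case: (_ \in X).
    by move: bx; rewrite (M y b x (esym E) (esym sxy) yb yx) eqxx.
  have sc : (c \in X) = (z \in X).
    apply/eqP/negPn/negP=> sc; have E : (c \in X) = (x \in X).
      by move: sc sz sxy; do 4! case: (_ \in X).
    by move: cy; rewrite (M x c y (esym E) sxy xc xy) eqxx.
  by move: bc; rewrite (M z b c (esym sb) (esym sc) zb zc) eqxx.
move=> x y z a b c /and3P[xy yz xz] /and3P[ax ay] /and4P[by_ bz cx cz].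
case/and3P=> az bx /and4P[cy ab bc ac].
have [sxy|sxy] := eqVneq (x \in X) (y \in X).
  by apply: (side x y z b c) => //; apply/and4P.
have [syz|syz] := eqVneq (y \in X) (z \in X).
  apply: (side y z x c a) => //; try by [rewrite r_sym | rewrite eq_sym].
  exact/and4P.
have sxz : (x \in X) = (z \in X).
  by move: sxy syz; do 3! case: (_ \in X).
apply: (side x z y b a) => //; try by [rewrite r_sym | rewrite eq_sym].
exact/and4P.
Qed.

(** Every triangle contains the centre, since the rest is bipartite; but the triangle erected on the
    side of the central triangle opposite to [c] avoids it. *)
Lemma cone_T_free c A : cone r setT c A -> T_free r.
Proof.
case=> _ _ xor _.
have tri x y z : r x y -> r y z -> r x z -> [|| x == c, y == c | z == c].
  move=> xy yz xz; apply/negPn; rewrite !negb_or; apply/negP=> /and3P[xc yc zc].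
  by move: xy yz xz; rewrite !xor ?in_setD1 ?xc ?yc ?zc ?in_setT //;
     do 3! case: (_ \in A).
have opp x y z b : r x y -> r x z -> r y z -> r b y -> r b z -> b != x ->
    x = c -> False.
  move=> xy xz yz by_ bz bx xc.
  move: (tri b y z by_ yz bz); rewrite -xc (negPf bx) /=.
  by case/orP=> /eqP E; [move: xy | move: xz]; rewrite E r_irr.
move=> x y z a b d /and3P[xy yz xz] /and3P[ax ay] /and4P[by_ bz dx dz].
case/and3P=> az bx /and4P[dy _ _ _].
have := tri x y z xy yz xz; case/or3P=> /eqP E.
- exact: (opp x y z b).
- by apply: (opp y x z d) => //; rewrite r_sym.
- by apply: (opp z x y a) => //; rewrite r_sym.
Qed.

End TFree.

Lemma deg_in_full (V : finType) (r : rel V) x (A : {set V}) y :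
  deg_in r x A = #|A| -> y \in A -> r x y.
Proof.
move=> + yA; rewrite (cardsD1 y) yA /deg_in (big_setD1 y) //=.
by have := deg_in_le r x (A :\ y); rewrite /deg_in; case: (r x y) => //; lia.
Qed.

(** * From edge sets to adjacency relations *)

Section Adjacency.

Variables (V : finType) (G : sgraph V).

Definition adj (x y : V) : bool := [set x; y] \in edges G.

Lemma edge_card2 e : e \in edges G -> #|e| == 2.
Proof. by have /forall_inP := edges2 G; apply. Qed.

Lemma adj_sym : symmetric adj.
Proof. by move=> x y; rewrite /adj setUC. Qed.

Lemma adj_irr : irreflexive adj.
Proof.
by move=> x; apply/negP=> /edge_card2; rewrite cards2 eqxx.
Qed.

Lemma edgeP e : e \in edges G -> exists x y, e = [set x; y] /\ adj x y.
Proof.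
move=> eG; have /cards2P[x [y [_ E]]] := edge_card2 eG.
by exists x, y; rewrite /adj -E.
Qed.

Lemma arcs_adj : arcs adj setT setT = 2 * #|edges G|.
Proof.
rewrite /arcs /deg_in pair_big_dep /=.
rewrite (eq_bigr (fun p : V * V => \sum_(e in edges G) (e == [set p.1; p.2]))).
  rewrite exchange_big /= -sum1_card big_distrr /=; apply: eq_bigr => e eG.
  have [x [y [E xy]]] := edgeP eG.
  have nxy : x != y by apply: contraTneq xy => ->; rewrite adj_irr.
  rewrite (bigD1 (x, y)) ?inE //= (bigD1 (y, x)) /=; last first.
    by rewrite !inE xpair_eqE eq_sym (negPf nxy).
  rewrite E eqxx setUC eqxx big1 // => -[u v] /=.
  rewrite !inE !xpair_eqE /= => /andP[n1 n2]; apply/eqP; rewrite eqb0.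
  apply/eqP=> Euv.
  have : x \in [set u; v] by rewrite -Euv !inE eqxx orbT.
  have : y \in [set u; v] by rewrite -Euv !inE eqxx.
  have : u \in [set y; x] by rewrite Euv !inE eqxx.
  have : v \in [set y; x] by rewrite Euv !inE eqxx orbT.
  rewrite !inE => /orP[]/eqP Ev /orP[]/eqP Eu; subst u v.
  - by rewrite eqxx (negPf nxy).
  - by move: n1; rewrite !eqxx.
  - by move: n2; rewrite !eqxx.
  - by rewrite orbb eq_sym (negPf nxy).
move=> [u v] _ /=; rewrite /adj; case: (boolP (_ \in _)) => [uv|uv].
  by rewrite (bigD1 [set u; v]) //= eqxx big1 // => e /andP[_ /negPf->].
rewrite big1 // => e eG; case: eqP => // E; by rewrite -E eG in uv.
Qed.

End Adjacency.

Lemma adj_rel_graph (V : finType) (r : rel V) x y :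
  adj (rel_graph r) x y = (x != y) && (r x y || r y x).
Proof. exact: rel_graphE. Qed.

Lemma graph_isoP (V W : finType) (G : sgraph V) (H : sgraph W) :
  graph_iso G H <->
  exists2 f : V -> W, bijective f & forall x y, adj H (f x) (f y) = adj G x y.
Proof.
split=> [[f bf E]|[f bf adjf]]; exists f => //.
  move=> x y; have imI := imset_inj (bij_inj bf).
  by rewrite /adj E -(mem_imset _ _ imI) imsetU !imset_set1.
have [g fK gK] := bf.
apply/setP=> e; apply/idP/imsetP=> [eH|[e' eG ->]].
  have [u [v [E uv]]] := edgeP eH; exists [set g u; g v].
    by rewrite -/(adj G _ _) -adjf !gK.
  by rewrite E imsetU !imset_set1 !gK.
have [u [v [-> uv]]] := edgeP eG.
by rewrite imsetU !imset_set1 -/(adj H _ _) adjf.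
Qed.

Lemma graphT_free (V : finType) (G : sgraph V) :
  ~~ contains G graphT <-> T_free (adj G).
Proof.
split=> [noT x y z a b c|Tfree].
  move=> /and3P[xy yz xz] /and3P[ax ay] /and4P[by_ bz cx cz].
  case/and3P=> az bx /and4P[cy ab bc ac].
  case/negP: noT.
  (* Listed in the numbering of [graphT]: 1, 2, 4 form the central triangle, and 0, 5, 3 are erected
     on the edges 12, 24, 14. *)
  pose s := [:: a; x; y; c; z; b].
  have ne u v : adj G u v -> u != v.
    by apply: contraTneq => ->; rewrite adj_irr.
  have us : uniq s.
    rewrite /s /= !inE !negb_or ab az (ne _ _ ax) (ne _ _ ay).
    rewrite (ne _ _ xy) (ne _ _ xz).
    rewrite (ne _ _ yz) ac (eq_sym x b) bx (eq_sym x c) (ne _ _ cx).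
    rewrite (eq_sym y c) cy (eq_sym y b) (ne _ _ by_) (ne _ _ cz).
    by rewrite (eq_sym c b) bc (eq_sym z b) (ne _ _ bz).
  apply/existsP; exists [ffun i : 'I_6 => nth x s i]; apply/andP; split.
    apply/injectiveP=> i j; rewrite !ffunE => /eqP.
    by rewrite nth_uniq //= => /eqP /val_inj.
  apply/forall_inP=> e /imset2P[u v _]; rewrite !inE => /andP[_ H] ->.
  rewrite imsetU !imset_set1 !ffunE -/(adj G _ _).
  have : (nat_of_ord u, nat_of_ord v) \in
      [:: (1, 2); (2, 4); (4, 1); (0, 1); (0, 2); (1, 3); (3, 4); (2, 5); (5, 4)].
    by case/andP: H.
  rewrite !inE !xpair_eqE; move: (nat_of_ord u) (nat_of_ord v) => i j.
  by rewrite /s; do ! [case/orP]; case/andP=> /eqP-> /eqP->; rewrite //= adj_sym.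
apply/negP=> /existsP[f /andP[/injectiveP injf /forall_inP fE]].
have fadj (i j : nat) (Hi : i < 6) (Hj : j < 6) :
    adj graphT (Ordinal Hi) (Ordinal Hj) ->
    adj G (f (Ordinal Hi)) (f (Ordinal Hj)).
  by move/fE; rewrite imsetU !imset_set1.
pose o k (Hk : k < 6) := f (Ordinal Hk).
apply: (Tfree (@o 1 isT) (@o 2 isT) (@o 4 isT) (@o 0 isT) (@o 5 isT) (@o 3 isT)).
- by rewrite !fadj // adj_rel_graph.
- by rewrite !fadj // adj_rel_graph.
- by rewrite /o !(inj_eq injf).
Qed.

Lemma T_free_iso (V W : finType) (G : sgraph V) (H : sgraph W) f :
    injective f -> (forall x y, adj H (f x) (f y) = adj G x y) ->
  T_free (adj H) -> T_free (adj G).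
Proof.
move=> injf fE TH x y z a b c; rewrite -!fE => tr pend ne.
by apply: TH tr pend _; rewrite !(inj_eq injf).
Qed.

Lemma edges_iso (V W : finType) (G : sgraph V) (H : sgraph W) :
  graph_iso G H -> #|edges G| = #|edges H|.
Proof.
by case=> f bf ->; rewrite card_imset //; apply: imset_inj; apply: bij_inj.
Qed.

Lemma graph_iso_sym (V W : finType) (G : sgraph V) (H : sgraph W) :
  graph_iso G H -> graph_iso H G.
Proof.
case/graph_isoP=> f [g fK gK] fE; apply/graph_isoP; exists g; first by exists f.
by move=> x y; rewrite -fE !gK.
Qed.

(** Needed because the maximum in [ex] ranges only over graphs on ['I_n]. *)
Lemma graph_iso_ord (V : finType) (G : sgraph V) :
  exists G' : sgraph 'I_#|V|, graph_iso G' G.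
Proof.
exists (rel_graph (fun i j => adj G (enum_val i) (enum_val j))).
apply/graph_isoP; exists enum_val; first exact: enum_val_bij.
move=> i j; rewrite adj_rel_graph (adj_sym G (enum_val j)) orbb.
by have [->|] := eqVneq i j; first by rewrite adj_irr.
Qed.

Lemma T_free_edges_le (V : finType) (G : sgraph V) : #|V| <> 5 ->
  T_free (adj G) -> #|edges G| <= turan_T #|V|.
Proof.
move=> n5 Tf; have [le _] := T_free_arcs (@adj_sym _ G) (@adj_irr _ G) Tf setT.
move: le; rewrite arcs_adj cardsT; move/eqP/negPf: n5 => ->; lia.
Qed.

(** The graph [H] serves as the witness that the upper bound [turan_T] is attained. *)
Lemma extremalE (V W : finType) (G : sgraph V) (H : sgraph W) :
    #|V| <> 5 -> #|W| = #|V| -> T_free (adj H) -> #|edges H| = turan_T #|W| ->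
  (extremal graphT G <-> T_free (adj G) /\ #|edges G| = turan_T #|V|).
Proof.
move=> n5 WV TH eH.
suff exE : ex #|V| graphT = turan_T #|V|.
  by rewrite /extremal exE; split=> -[T E]; split=> //; apply/graphT_free.
apply/eqP; rewrite eqn_leq; apply/andP; split.
  apply/bigmax_leqP=> G' /graphT_free T'.
  by have := T_free_edges_le (G := G'); rewrite card_ord => /(_ n5 T').
have [H' iso] := graph_iso_ord H.
rewrite -WV -eH -(edges_iso iso); apply: leq_bigmax_cond.
apply/graphT_free; case/graph_isoP: iso => f /bij_inj injf fE.
exact: T_free_iso injf fE TH.
Qed.

Lemma graph_iso_bip (V : finType) (G : sgraph V) i j (rX : rel 'I_i)
    (rY : rel 'I_j) (s t : seq V) (x0 : V) :
    uniq (s ++ t) -> size s = i -> size t = j -> i + j = #|V| ->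
    (forall k l : 'I_i,
       adj G (nth x0 s k) (nth x0 s l) = (k != l) && (rX k l || rX l k)) ->
    (forall k l : 'I_j,
       adj G (nth x0 t k) (nth x0 t l) = (k != l) && (rY k l || rY l k)) ->
    {in s & t, forall x y, adj G x y} ->
  graph_iso G (rel_graph (bip_rel rX rY)).
Proof.
move=> us si tj ij adjX adjY adjXY; apply: graph_iso_sym; apply/graph_isoP.
pose g (u : 'I_i + 'I_j) := nth x0 (s ++ t) (match u with
  | inl k => k | inr l => i + l end).
have gl k : g (inl k) = nth x0 s k by rewrite /g nth_cat si ltn_ord.
have gr l : g (inr l) = nth x0 t l.
  by rewrite /g nth_cat si ltnNge leq_addr /= addKn.
have adjg k l : adj G (g (inl k)) (g (inr l)).
  by rewrite gl gr adjXY // mem_nth ?si ?tj.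
exists g.
  apply: inj_card_bij; last by rewrite card_sum !card_ord ij.
  move=> [k|l] [k'|l'] /eqP; rewrite nth_uniq ?size_cat ?si ?tj //
    ?ltn_add2l ?(ltn_addr _ (ltn_ord _)) // ?eqn_add2l => /eqP E.
  - by congr inl; apply: val_inj.
  - by have := ltn_ord k; rewrite E ltnNge leq_addr.
  - by have := ltn_ord k'; rewrite -E ltnNge leq_addr.
  - by congr inr; apply: val_inj.
move=> [k|l] [k'|l']; rewrite adj_rel_graph /=.
- by rewrite !gl adjX.
- by rewrite adjg.
- by rewrite adj_sym adjg.
- by rewrite !gr adjY.
Qed.

(** * The graphs $T^i_n$ and $S^i_n$ *)

Lemma sum_matching_rel k :
  \sum_(i < k) \sum_(j < k) ((i != j) && (i./2 == j./2)) = 2 * k./2.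
Proof.
pose f (i j : nat) : nat := (i != j) && (i./2 == j./2).
suff [] : \sum_(i < k) \sum_(j < k) f i j = 2 * k./2 /\
   \sum_(i < k.+1) \sum_(j < k.+1) f i j = 2 * k.+1./2 by [].
have step m : \sum_(i < m.+2) \sum_(j < m.+2) f i j =
    2 + \sum_(i < m) \sum_(j < m) f i j.
  have rowS a : \sum_(j < m.+2) f a.+2 j = \sum_(j < m) f a j.
    by rewrite !big_ord_recl.
  rewrite big_ord_recl [X in _ + X]big_ord_recl.
  rewrite (eq_bigr (fun a : 'I_m => \sum_(j < m) f a j)) => [|a _]; last first.
    exact: rowS.
  by rewrite addnA; congr (_ + _); rewrite !big_ord_recl !big1.
elim: k => [|k [IH IH']]; first by rewrite !big_ord_recl !big_ord0.
by split=> //; rewrite step IH /=; lia.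
Qed.

Lemma sum_setT (T : finType) (F : T -> nat) :
  \sum_(x in setT) F x = \sum_x F x.
Proof. by apply: eq_bigl => x; rewrite inE. Qed.

Lemma T_graph_edges n i :
  #|edges (T_graph n i)| = i * (n - i) + i./2 + (n - i)./2.
Proof.
suff : 2 * #|edges (T_graph n i)| = 2 * (i * (n - i) + i./2 + (n - i)./2).
  by move/eqP; rewrite eqn_pmul2l // => /eqP.
rewrite -arcs_adj /arcs /deg_in sum_setT big_sumType /=.
have E (u : 'I_i + 'I_(n - i)) : \sum_(v in setT) adj (T_graph n i) u v =
    \sum_k adj (T_graph n i) u (inl k) + \sum_l adj (T_graph n i) u (inr l).
  by rewrite sum_setT big_sumType.
rewrite (eq_bigr (fun k : 'I_i =>
    \sum_(l < i) ((k != l) && (k./2 == l./2)) + (n - i))).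
  rewrite [X in _ + X](eq_bigr (fun k : 'I_(n - i) =>
      i + \sum_(l < n - i) ((k != l) && (k./2 == l./2)))).
    rewrite !big_split /= !sum_matching_rel !sum_nat_const !card_ord.
    by rewrite (mulnC (n - i)); lia.
  move=> k _; rewrite E; congr (_ + _).
    rewrite -[RHS](card_ord i) -sum1_card; apply: eq_bigr => l _.
    by rewrite adj_rel_graph.
  apply: eq_bigr => l _; rewrite adj_rel_graph /= /matching_rel.
  by rewrite (eq_sym l./2) orbb.
move=> k _; rewrite E; congr (_ + _).
  apply: eq_bigr => l _; rewrite adj_rel_graph /= /matching_rel.
  by rewrite (eq_sym l./2) orbb.
rewrite -[RHS](card_ord (n - i)) -sum1_card; apply: eq_bigr => l _.
by rewrite adj_rel_graph.
Qed.

Lemma T_graph_T_free n i : T_free (adj (T_graph n i)).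
Proof.
pose X : {set 'I_i + 'I_(n - i)} := [set u | if u is inl _ then true else false].
apply: (@two_matchings_T_free _ _ (@adj_sym _ _) (@adj_irr _ _) X).
have half (k l m : nat) : k != l -> k != m -> k./2 = l./2 -> k./2 = m./2 -> l = m.
  lia.
move=> [k|k] [l|l] [m|m]; rewrite !inE //= => _ _;
  rewrite !adj_rel_graph /= /matching_rel => /andP[kl] /orP H /andP[km] /orP H';
  have E : k./2 = l./2 by [case: H => /eqP];
  have E' : k./2 = m./2 by [case: H' => /eqP];
  by congr (_ _); apply: val_inj; apply: (half k).
Qed.

(** The star centre is joined to everything and leaves a complete bipartite graph with classes of
    sizes i-1 and n-i; the inequalities are their balance. *)
Lemma S_graph_cone n i : 0 < i <= n -> i <= (n - i).+2 -> n - i <= i ->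
  exists c A, cone (adj (S_graph n i)) setT c A.
Proof.
case: i => // i /= le_in b1 b2.
exists (inl ord0), [set u | if u is inl _ then true else false].
have adjE := adj_rel_graph
  (bip_rel (@star_rel i.+1) (fun _ _ : 'I_(n - i.+1) => false)).
split.
- by rewrite inE.
- move=> [k|k]; rewrite !inE andbT adjE //=.
  by rewrite [in X in _ -> X]eq_sym => ->.
- move=> [k|k] [l|l]; rewrite !inE !andbT !adjE //= => k0 l0; last by rewrite andbF.
  rewrite /star_rel (negPf (_ : nat_of_ord k != 0)) //.
  by rewrite (negPf (_ : nat_of_ord l != 0)) // andbF.
have inlI : injective (@inl 'I_i.+1 'I_(n - i.+1)) by move=> x y [].
have inrI : injective (@inr 'I_i.+1 'I_(n - i.+1)) by move=> x y [].
have -> : (setT :\ inl ord0) :&: [set u | if u is inl _ then true else false] =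
    inl @: (setT :\ ord0) :> {set 'I_i.+1 + 'I_(n - i.+1)}.
  apply/setP=> -[k|l]; rewrite !inE.
    by rewrite (mem_imset _ _ inlI) !inE !andbT.
  by rewrite andbF; apply/esym/imsetP => -[].
have -> : (setT :\ inl ord0) :\: [set u | if u is inl _ then true else false] =
    inr @: setT :> {set 'I_i.+1 + 'I_(n - i.+1)}.
  apply/setP=> -[k|l]; rewrite !inE /=.
    by apply/esym/imsetP => -[].
  by rewrite (mem_imset _ _ inrI) inE.
rewrite (card_imset _ inlI) (card_imset _ inrI).
have -> : #|[set: 'I_i.+1] :\ ord0| = i.
  by have := cardsD1 ord0 [set: 'I_i.+1]; rewrite in_setT cardsT card_ord => -[].
by rewrite cardsT card_ord.
Qed.

(* The sizes of the larger class in the extremal graphs [T_graph n i]. *)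
Definition balanced (n i : nat) : Prop :=
  [\/ n = 0 %[mod 4] /\ i = n./2, n = 1 %[mod 4] /\ i = uphalf n,
      n = 2 %[mod 4] /\ (i = n./2 \/ i = n./2 + 1) |
      n = 3 %[mod 4] /\ i = uphalf n].

Lemma balanced_turan n i : 0 < n -> balanced n i ->
  i * (n - i) + i./2 + (n - i)./2 = turan_T n.
Proof.
move=> n0; have [t0 t1 t2 t3] := turan_T_mod (n %/ 4).
move: (divn_eq n 4); set k := n %/ 4 in t0 t1 t2 t3 *; rewrite (mulnC k).
move=> + [] [r4 H]; rewrite r4.
- rewrite addn0 => E; have [-> ->] : i = 2 * k /\ n - i = 2 * k by lia.
  rewrite E t0; lia.
- move=> E; have [-> ->] : i = 2 * k + 1 /\ n - i = 2 * k by lia.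
  rewrite E t1; lia.
- move=> E; case: H => H.
    have [-> ->] : i = 2 * k + 1 /\ n - i = 2 * k + 1 by lia.
    rewrite E t2; lia.
  have [-> ->] : i = 2 * k + 2 /\ n - i = 2 * k by lia.
  rewrite E t2; lia.
move=> E; have [-> ->] : i = 2 * k + 2 /\ n - i = 2 * k + 1 by lia.
rewrite E t3; lia.
Qed.

(** With i - j equal to 2e or 2e+1, unbalance costs about e^2 cross edges, while the matchings gain
    at most one edge. That gain occurs for n = 2 mod 4, where equal classes are odd, so e = 1 ties
    with e = 0; in the other residues e = 0. *)
Lemma turan_balanced i j : j <= i ->
  turan_T (i + j) <= i * j + i./2 + j./2 -> balanced (i + j) i.
Proof.
move=> ji; set n := i + j => le; have [t0 t1 t2 t3] := turan_T_mod (n %/ 4).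
move: (divn_eq n 4) (ltn_pmod n (isT : 0 < 4)).
set k := n %/ 4 in t0 t1 t2 t3 *; rewrite (mulnC k).
have [d di] : exists d, i = j + d by exists (i - j); lia.
have nd : n = 2 * j + d by rewrite /n di; lia.
have [e de] : exists e, d = 2 * e + odd d by exists d./2; lia.
have ee : e <= e * e by case: (e) => // m; rewrite leq_pmulr.
case: (n %% 4) => [|[|[|[|//]]]] nk _; rewrite nk ?addn0 ?t0 ?t1 ?t2 ?t3 in le.
- have [ke dE] : 2 * k = j + e /\ d = 2 * e by lia.
  have sq : (2 * k) * (2 * k) = (j + e) * (j + e) by rewrite ke.
  constructor 1; suff : e = 0 by lia.
  by move: le; rewrite di dE; lia.
- have [ke dE] : 2 * k = j + e /\ d = 2 * e + 1 by lia.
  have sq : (2 * k) * (2 * k) = (j + e) * (j + e) by rewrite ke.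
  constructor 2; suff : e = 0 by lia.
  by move: le; rewrite di dE; lia.
- have [ke dE] : 2 * k + 1 = j + e /\ d = 2 * e by lia.
  have sq : (2 * k + 1) * (2 * k + 1) = (j + e) * (j + e) by rewrite ke.
  constructor 3; suff : e * e <= 1.
    case: (e) ke dE => [|[|m]] ke dE; [lia | lia | by lia].
  by move: le; rewrite di dE; lia.
have [ke dE] : 2 * k + 1 = j + e /\ d = 2 * e + 1 by lia.
have sq : (2 * k + 1) * (2 * k + 1) = (j + e) * (j + e) by rewrite ke.
constructor 4; suff : e = 0 by lia.
by move: le; rewrite di dE; lia.
Qed.

(** * Classification of the extremal graphs *)

(** The edges inside each side and across are bounded separately. The edge count first forces
    balanced sizes, for which the three bounds add up to exactly f, so both matchings are maximum
    and all cross edges are present. *)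
Lemma two_matchings_iso (V : finType) (G : sgraph V) X :
    0 < #|V| -> two_matchings (adj G) X -> #|edges G| = turan_T #|V| ->
  exists2 i, balanced #|V| i & graph_iso G (T_graph #|V| i).
Proof.
move=> V0 MX eG; wlog le_X : X MX / #|~: X| <= #|X|.
  move=> H; have [|/ltnW] := leqP #|~: X| #|X|; first exact: H.
  rewrite -{1}(setCK X); apply: H => x y z; rewrite !inE => xy xz.
  by apply: MX; apply: negb_inj.
have cX := cardsC X; have symG := @adj_sym _ G; have irrG := @adj_irr _ G.
have [leX eqX] := matching_arcs symG irrG (fun x y z (xX : x \in X) (yX : y \in X)
  (zX : z \in X) => MX x y z (etrans xX (esym yX)) (etrans xX (esym zX))).
have inC x y : x \in ~: X -> y \in ~: X -> (x \in X) = (y \in X).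
  by rewrite !inE => /negPf-> /negPf->.
have [leY eqY] := matching_arcs symG irrG (fun x y z (xX : x \in ~: X)
  (yX : y \in ~: X) (zX : z \in ~: X) => MX x y z (inC x y xX yX) (inC x z xX zX)).
have leD x : x \in ~: X -> deg_in (adj G) x X <= #|X| by rewrite deg_in_le.
have leYX := arcs_le leD.
have := arcs_adj G; rewrite eG (arcs_setD symG (subsetT X)) setTD => E.
have bal : balanced #|V| #|X|.
  rewrite -cX; apply: turan_balanced => //; rewrite cX.
  by move: E leX leY leYX; clear; lia.
exists #|X| => //.
have cYV : #|V| - #|X| = #|~: X| by rewrite -cX addKn.
have T_eq := balanced_turan V0 bal; rewrite cYV in T_eq.
have [|s [us sX nths]] := eqX; first by move: E T_eq leX leY leYX; clear; lia.
have [|t [ut tY ntht]] := eqY; first by move: E T_eq leX leY leYX; clear; lia.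
have degE := arcs_le_eq leD _; have {}degE x := degE _ x.
have ss : size s = #|X| by rewrite -(card_uniqP us); apply: eq_card.
have st : size t = #|~: X| by rewrite -(card_uniqP ut); apply: eq_card.
have /card_gt0P[x0 _] := V0.
apply: (@graph_iso_bip _ _ _ _ _ _ s t x0) => //.
- rewrite cat_uniq us ut andbT /=; apply/hasPn => x.
  by rewrite tY sX inE.
- by rewrite st.
- by rewrite cYV.
- move=> k l; rewrite nths ?ss // /matching_rel.
  by rewrite (eq_sym l./2) orbb.
- move=> k l; rewrite ntht ?st -?cYV // /matching_rel.
  by rewrite (eq_sym l./2) orbb.
move=> x y; rewrite sX tY => xX yY; rewrite adj_sym.
apply: (deg_in_full (A := X)) => //; apply: degE => //.
by move: E T_eq leX leY leYX; clear; lia.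
Qed.

(** The centre is put together with the smaller class, which gives that side size [uphalf #|V|]. *)
Lemma cone_iso (V : finType) (G : sgraph V) c A :
  cone (adj G) setT c A -> graph_iso G (S_graph #|V| (uphalf #|V|)).
Proof.
set S := setT :\ c.
wlog le_A : A / #|S :&: A| <= #|S :\: A|.
  move=> H coneA; have [le|/ltnW le] := leqP #|S :&: A| #|S :\: A|.
    exact: H coneA.
  by apply: (H (~: A)); [rewrite [_ :\: ~: A]setDE setCK -setDE | apply: coneC].
case=> _; rewrite -/S => cx xor [_ b2].
have cS : #|V| = #|S|.+1 by rewrite -cardsT (cardsD1 c) in_setT.
have cA := cardsID A S.
have nthA k : k < #|S :&: A| -> nth c (enum (S :&: A)) k \in S :&: A.
  by move=> kA; rewrite -mem_enum mem_nth // -cardE.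
have nthB k : k < #|S :\: A| -> nth c (enum (S :\: A)) k \in S :\: A.
  by move=> kA; rewrite -mem_enum mem_nth // -cardE.
have iE : uphalf #|V| = #|S :&: A|.+1 by move: cS cA le_A b2; clear; lia.
have jE : #|V| - uphalf #|V| = #|S :\: A| by move: cS cA le_A b2; clear; lia.
apply: (@graph_iso_bip _ _ _ _ _ _ (c :: enum (S :&: A)) (enum (S :\: A)) c).
- rewrite /= cat_uniq !enum_uniq mem_cat !mem_enum !inE eqxx /= andbT.
  rewrite ?andbF /=; apply/hasPn => x; rewrite !mem_enum => /setDP[_ xA].
  by apply: contra xA => /setIP[].
- by rewrite /= -cardE.
- by rewrite -cardE.
- by move: cS; clear; lia.
- move=> [[|k] Hk] [[|l] Hl] /=; rewrite /star_rel /=.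
  + by rewrite adj_irr.
  + by rewrite cx //; have /setIP[] : nth c (enum (S :&: A)) l \in S :&: A
      by apply: nthA; rewrite -ltnS -iE.
  + by rewrite adj_sym cx //; have /setIP[] : nth c (enum (S :&: A)) k \in S :&: A
      by apply: nthA; rewrite -ltnS -iE.
  rewrite andbF.
  have /setIP[kS kA] : nth c (enum (S :&: A)) k \in S :&: A.
    by apply: nthA; rewrite -ltnS -iE.
  have /setIP[lS lA] : nth c (enum (S :&: A)) l \in S :&: A.
    by apply: nthA; rewrite -ltnS -iE.
  by rewrite xor // kA lA.
- have ltB (k : 'I_(#|V| - uphalf #|V|)) : k < #|S :\: A| by rewrite -jE.
  move=> k l; have /setDP[kS /negPf kA] := nthB _ (ltB k).
  have /setDP[lS /negPf lA] := nthB _ (ltB l).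
  by rewrite xor // kA lA andbF.
move=> x y; rewrite inE !mem_enum => /predU1P[->|/setIP[xS xA]] /setDP[yS yA].
  exact: cx.
by rewrite xor // xA (negPf yA).
Qed.

Lemma extremal_structure (V : finType) (G : sgraph V) :
    0 < #|V| -> #|V| <> 5 -> #|V| <> 6 -> T_free (adj G) ->
    #|edges G| = turan_T #|V| ->
  (exists2 i, balanced #|V| i & graph_iso G (T_graph #|V| i)) \/
  #|V| <> 0 %[mod 4] /\ graph_iso G (S_graph #|V| (uphalf #|V|)).
Proof.
move=> V0 n5 n6 Tf eG; have symG := @adj_sym _ G; have irrG := @adj_irr _ G.
have arcsE := arcs_adj G; rewrite eG in arcsE.
have [_ lt] := T_free_arcs symG irrG Tf setT; rewrite cardsT in lt.
have K5 : K5minus_free (adj G) setT.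
  move=> x y z u v sV; apply/negP=> K.
  have := lt (fun F => elimN idP (F x y z u v sV) K) n5 n6.
  by rewrite arcsE ltnn.
have [K4|[w [x [y [z [_ K]]]]]] := K4_freeVex (adj G) setT; last first.
  have [X MX] := K4_extremal symG irrG Tf K5 K arcsE.
  by left; apply: two_matchings_iso MX eG.
right; have T0 : 0 < #|[set: V]| by rewrite cardsT.
have [le eq] := K4_free_arcs symG irrG Tf K4 T0.
rewrite cardsT arcsE /turan_T in le eq; have q0 := quarter_sq_gt0 V0.
(* If 4 divides the order, the bound without K_4 is one below f, so this case cannot occur. *)
have n4 : ~~ (4 %| #|V|) by apply/negP=> n4; move: le; rewrite n4; clear; lia.
have [|c [A coneA]] := eq; first by move: q0; rewrite n4; clear; lia.
split; last exact: cone_iso coneA.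
by move=> E; move: n4; rewrite /dvdn E.
Qed.

Lemma T_graph_extremal (V : finType) (G : sgraph V) i :
    0 < #|V| -> balanced #|V| i -> graph_iso G (T_graph #|V| i) ->
  T_free (adj G) /\ #|edges G| = turan_T #|V|.
Proof.
move=> V0 bal iso; split.
  case/graph_isoP: iso => f /bij_inj injf fE.
  exact: T_free_iso injf fE (@T_graph_T_free _ _).
by rewrite (edges_iso iso) T_graph_edges balanced_turan.
Qed.

Lemma S_graph_extremal (V : finType) (G : sgraph V) :
    0 < #|V| -> #|V| <> 0 %[mod 4] ->
    graph_iso G (S_graph #|V| (uphalf #|V|)) ->
  T_free (adj G) /\ #|edges G| = turan_T #|V|.
Proof.
move=> V0 n4 iso.
have [||| c [A coneA]] := @S_graph_cone #|V| (uphalf #|V|); try lia.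
split.
  case/graph_isoP: iso => f /bij_inj injf fE; apply: T_free_iso injf fE _.
  by apply: cone_T_free coneA; [apply: adj_sym | apply: adj_irr].
have := cone_arcs (@adj_sym _ (S_graph _ _)) (@adj_irr _ _) coneA.
rewrite arcs_adj -(edges_iso iso) cardsT card_sum !card_ord subnKC; last lia.
have q0 := quarter_sq_gt0 V0.
have -> : turan_T #|V| = quarter_sq #|V| - 1.
  rewrite /turan_T; congr (_ - _); apply/eqP; rewrite eqb1.
  by apply/eqP => n4'; apply: n4.
lia.
Qed.

(** In every residue class [uphalf #|V|] is a balanced size, so one [T_graph] attains the bound
    uniformly. *)
Lemma extremal_graphTE (V : finType) (G : sgraph V) : 0 < #|V| -> #|V| <> 5 ->
  extremal graphT G <-> T_free (adj G) /\ #|edges G| = turan_T #|V|.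
Proof.
move=> V0 n5; set i := uphalf #|V|.
have bal : balanced #|V| i.
  have := ltn_pmod #|V| (isT : 0 < 4); rewrite /balanced /i.
  case E : (#|V| %% 4) => [|[|[|[|//]]]] _.
  - by constructor 1; lia.
  - by constructor 2; lia.
  - by constructor 3; lia.
  - by constructor 4; lia.
have cW : #|{: 'I_i + 'I_(#|V| - i)}| = #|V|.
  by rewrite card_sum !card_ord /i; lia.
apply: (@extremalE V _ G (T_graph #|V| i)) => //; first exact: T_graph_T_free.
by rewrite T_graph_edges cW balanced_turan.
Qed.

Theorem theorem6 (n : nat) (n_gt0 : 0 < n) (n_neq5 : n <> 5) (n_neq6 : n <> 6) :
  [/\ n = 0 %[mod 4] ->
        forall (V : finType) (G : sgraph V), #|V| = n ->
          (extremal graphT G <-> graph_iso G (T_graph n n./2)),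
      n = 1 %[mod 4] ->
        forall (V : finType) (G : sgraph V), #|V| = n ->
          (extremal graphT G <->
             graph_iso G (T_graph n (uphalf n)) \/
             graph_iso G (S_graph n (uphalf n))),
      n = 2 %[mod 4] ->
        forall (V : finType) (G : sgraph V), #|V| = n ->
          (extremal graphT G <->
             [\/ graph_iso G (T_graph n n./2),
                 graph_iso G (T_graph n (n./2 + 1)) |
                 graph_iso G (S_graph n n./2)])
    & n = 3 %[mod 4] ->
        forall (V : finType) (G : sgraph V), #|V| = n ->
          (extremal graphT G <->
             graph_iso G (T_graph n (uphalf n)) \/
             graph_iso G (S_graph n (uphalf n)))].
Proof.
have fwd (V : finType) (G : sgraph V) : #|V| = n -> extremal graphT G ->
    (exists2 i, balanced n i & graph_iso G (T_graph n i)) \/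
    n <> 0 %[mod 4] /\ graph_iso G (S_graph n (uphalf n)).
  move=> Vn; subst n => /extremal_graphTE[] // Tf eG.
  exact: extremal_structure.
have bwdT (V : finType) (G : sgraph V) i : #|V| = n -> balanced n i ->
    graph_iso G (T_graph n i) -> extremal graphT G.
  move=> Vn; subst n => bal iso; apply/extremal_graphTE => //.
  exact: T_graph_extremal iso.
have bwdS (V : finType) (G : sgraph V) : #|V| = n -> n <> 0 %[mod 4] ->
    graph_iso G (S_graph n (uphalf n)) -> extremal graphT G.
  move=> Vn; subst n => n4 iso; apply/extremal_graphTE => //.
  exact: S_graph_extremal iso.
split=> nk V G Vn; split.
- case/(fwd _ _ Vn) => [[i bal iso]|[/(_ nk)//]].
  by case: bal => -[nk' ie]; try (by rewrite nk in nk'); rewrite -ie.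
- by apply: bwdT => //; constructor 1.
- case/(fwd _ _ Vn) => [[i bal iso]|[_ iso]]; last by right.
  by left; case: bal => -[nk' ie]; try (by rewrite nk in nk'); rewrite -ie.
- case=> iso; first by apply: bwdT iso => //; constructor 2.
  by apply: bwdS iso => //; rewrite nk.
- have un : uphalf n = n./2 by lia.
  case/(fwd _ _ Vn) => [[i bal iso]|[_ iso]]; last by constructor 3; rewrite -un.
  case: bal => -[nk' ie]; try by rewrite nk in nk'.
  by case: ie => <-; [constructor 1|constructor 2].
- case=> iso.
  + by apply: bwdT iso => //; constructor 3; split=> //; left.
  + by apply: bwdT iso => //; constructor 3; split=> //; right.
  + by apply: bwdS => //; [rewrite nk | have -> : uphalf n = n./2 by lia].
- case/(fwd _ _ Vn) => [[i bal iso]|[_ iso]]; last by right.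
  by left; case: bal => -[nk' ie]; try (by rewrite nk in nk'); rewrite -ie.
case=> iso; first by apply: bwdT iso => //; constructor 4.
by apply: bwdS iso => //; rewrite nk.
Qed.
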